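(* For $0<\rho<1$, the measure $\nu_{1,\rho}$ has a positive analytic density on $\mathbf{R}$ given by $$\psi_{1,\rho}(x)=\frac1\pi\,\frac{\sin^2\theta}{2\rho+\frac2\pi(1-2\rho)\theta},$$ where $\theta\in(0,\pi)$ is the only solution of the equation $$x=\left(2\rho+\frac2\pi(1-2\rho)\theta\right)\cot\theta+\frac2\pi(1-2\rho)\log\frac{\sin\theta}{2\rho+\frac2\pi(1-2\rho)\theta}.$$ The support of the measure $\nu_{1,0}$ is the interval $\left(-\infty,\frac2\pi\left(1+\log\frac\pi2\right)\right]$, and $\nu_{1,0}$ has a density, analytic on the interior of this support, given there by $$\psi_{1,0}(x)=\frac{\sin^2\theta}{2\theta},$$ where $\theta\in(0,\pi)$ is the only solution of the equation $$x=\frac2\pi\theta\cot\theta+\frac2\pi\log\frac{\pi\sin\theta}{2\theta}.$$ The measure $\nu_{1,1}$ is the image of $\nu_{1,0}$ under the map $t\mapsto-t$.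
   Context: For a Borel probability measure $\mu$ on $\mathbf{R}$ let $G_\mu(z)=\int_{-\infty}^\infty\frac{1}{z-t}\,d\mu(t)$ and $F_\mu=1/G_\mu$ on $\mathbf{C}^+=\{\Im z>0\}$. For every $\eta>0$ there is $M>0$ such that $F_\mu$ has an analytic inverse $F_\mu^{-1}$ on $\Gamma_{\eta,M}=\{x+iy:y>M,|x|<\eta y\}$ with values in $\mathbf{C}^+$ ($F_\mu(F_\mu^{-1}(z))=z$, $F_\mu^{-1}(z)/z\to1$ as $z\to\infty$). The Voiculescu transform is $\phi_\mu(z)=F_\mu^{-1}(z)-z$; it determines $\mu$. For $0\le\rho\le1$, $\nu_{1,\rho}$ denotes the ($\boxplus$-stable) probability measure on $\mathbf{R}$ whose Voiculescu transform is $\phi(z)=-2\rho i+\frac{2(2\rho-1)}{\pi}\log z$, with the principal branch of $\log$ on $\mathbf{C}^+$. *)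

(* Defs.v *)
From HB Require Import structures.
From mathcomp Require Import all_boot all_order all_algebra complex.
From mathcomp Require Import all_classical all_reals all_analysis.

Set Implicit Arguments.
Unset Strict Implicit.
Unset Printing Implicit Defensive.

Import Order.TTheory GRing.Theory Num.Theory.
Import numFieldNormedType.Exports.

Local Open Scope classical_set_scope.
Local Open Scope ring_scope.
Local Open Scope complex_scope.

(* Used with [K = R] (real analyticity) and with [K = R[i]]. In the latter case
   [0 < r] forces [r] to be real, as for the order of any numClosedFieldType. *)
Definition analytic_at (K : numFieldType) (f : K -> K) (x : K) : Prop :=
  exists (a : K^nat) (r : K), 0 < r /\
    forall y : K, `|y - x| < r ->
      series (fun n => a n * (y - x) ^+ n) @ \oo --> f y.

Definition analytic_on (K : numFieldType) (D : set K) (f : K -> K) : Prop :=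
  forall x, D x -> analytic_at f x.

Section real_measures.
Context {R : realType}.

Definition measure_support (mu : {measure set (measurableTypeR R) -> \bar R})
    : set R :=
  [set x | forall U : set R, open U -> U x -> (0 < mu U)%E].

Definition has_density (mu : {measure set (measurableTypeR R) -> \bar R})
    (psi : R -> R) : Prop :=
  [/\ measurable_fun [set: measurableTypeR R] (psi : measurableTypeR R -> R),
      forall x, 0 <= psi x &
      forall A : set (measurableTypeR R), measurable A ->
        mu A = (\int[lebesgue_measure]_(x in A) (psi x)%:E)%E].

End real_measures.

Section voiculescu.
Context {R : realType}.
Local Notation C := R[i].

Definition upper_half_plane : set C := [set z | 0 < complex.Im z].

Section transforms.
Variable mu : probability (measurableTypeR R) R.

Definition cauchy_transform (z : C) : C :=
  (\int[mu]_t complex.Re ((z - t%:C)^-1)) +i*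
  (\int[mu]_t complex.Im ((z - t%:C)^-1)).

Definition F_transform (z : C) : C := (cauchy_transform z)^-1.

End transforms.

(* [Gamma_{eta, M}] *)
Definition truncated_cone (eta M : R) : set C :=
  [set z | M < complex.Im z /\ `|complex.Re z| < eta * complex.Im z].

Definition is_F_inverse (mu : probability (measurableTypeR R) R)
    (eta M : R) (Finv : C -> C) : Prop :=
  [/\ analytic_on (truncated_cone eta M) Finv,
      forall z, truncated_cone eta M z -> upper_half_plane (Finv z),
      forall z, truncated_cone eta M z -> F_transform mu (Finv z) = z &
      forall e : R, 0 < e -> exists K : R, forall z, truncated_cone eta M z ->
        K%:C < `|z| -> `|Finv z / z - 1| < e%:C].

(* The domain of [F^-1], hence of the Voiculescu transform, is a union of
   truncated cones containing some [Gamma_{eta, M}] for every [eta]; two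
   transforms are identified when they agree on such a domain. *)
Definition is_voiculescu_transform (mu : probability (measurableTypeR R) R)
    (phi : C -> C) : Prop :=
  forall eta : R, 0 < eta -> exists M : R, 0 < M /\
    exists Finv : C -> C, is_F_inverse mu eta M Finv /\
      forall z, truncated_cone eta M z -> phi z = Finv z - z.

(* Values in [(-pi, pi]]; in [(0, pi)] on the upper half-plane. *)
Definition principal_arg (z : C) : R :=
  let a := acos (complex.Re z / complex.Re `|z|) in
  if 0 <= complex.Im z then a else - a.

Definition principal_log (z : C) : C :=
  ln (complex.Re `|z|) +i* principal_arg z.

Definition phi1 (rho : R) (z : C) : C :=
  - (0 +i* (2 * rho)) + (2 * (2 * rho - 1) / pi)%:C * principal_log z.

Definition is_nu1 (rho : R) (nu : probability (measurableTypeR R) R) : Prop :=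
  is_voiculescu_transform nu (phi1 rho).

End voiculescu.

Definition cot {R : realType} (x : R) : R := cos x / sin x.

(* Main.v *)
(* Put H z = z - 2 rho i - c log z with c = (2/pi)(1 - 2 rho), so that
   G (H z) = 1/z on a truncated cone.  Differentiating along the imaginary axis,
   G' (1 - c G) + G^2 = 0 at the points H (ir).  The left-hand side is analytic
   in C^+, hence vanishes there, and integrating along segments gives
   H (1 / G w) = w for all w in C^+.  With w = x + i e and 1 / G w of argument
   theta, this reads x = X_e(theta) and - Im G w = sin^2 theta / (w(theta) + e),
   where X_e is strictly decreasing.  As e -> 0 the solutions theta converge, so
   - Im G / pi converges boundedly to psi, and Stieltjes inversion applies.

   On the boundary curve z(x) one has z' = z / (z - c).  Thus g = 1/z,
   al = 1/(z - c) and q = z al^2 satisfy g' = - g al, al' = - al q and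
   q' = q al - 2 q^2, so the n-th derivative of g is O(n! B^n) locally and
   psi = - Im g / pi is analytic.

   The case rho = 1 follows from rho = 0 through theta -> pi - theta. *)
Require Import Defs.
From HB Require Import structures.
From mathcomp Require Import all_boot all_order all_algebra complex.
From mathcomp Require Import all_classical all_reals all_analysis.
From mathcomp Require Import measurable_realfun ring lra.
Set Implicit Arguments.
Unset Strict Implicit.
Unset Printing Implicit Defensive.
Import Order.TTheory GRing.Theory Num.Theory.
Import numFieldNormedType.Exports.
Local Open Scope classical_set_scope.
Local Open Scope ring_scope.

Local Open Scope complex_scope.
Local Notation Re := complex.Re.
Local Notation Im := complex.Im.
Local Notation normc := ComplexField.Normc.normc.

(** The hypothesis controls G only through truncated cones, whereas Stieltjes inversion needs it up
    to the real axis. The relation H (1 / G) = id contains a logarithm, but the defect of the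
    differential equation is a polynomial in G and G', so its local expansions follow from the
    geometric series of 1 / (w - t) by sums, products and integration alone. This is why the
    equation is continued, and not the relation. A single ray, the imaginary axis, suffices to
    start: there log is ln r + i pi / 2.

    X_e is X with 2 rho replaced by 2 rho + e, so one monotonicity statement serves the half-plane
    and its boundary; it rests on dX/dtheta = - |z - c|^2 / Im z. For 0 < rho < 1 the width w(theta)
    is bounded below on (0, pi), which bounds - Im G. For rho = 0 it vanishes at theta = 0, and sin
    theta <= theta takes over, also beyond the edge of the support, where the angles tend to 0. The
    uniform bound on - Im G excludes atoms, which the inversion on intervals would count by half at
    the endpoints. *)

Section ComplexModulus.
Variable R : realType.
Local Notation C := R[i].
Implicit Types z w : C.

Lemma normcE z : normc z = Num.sqrt (Re z ^+ 2 + Im z ^+ 2).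
Proof. by case: z. Qed.

Lemma normc_ge0 z : 0 <= normc z.
Proof. by rewrite normcE sqrtr_ge0. Qed.

Lemma sqr_normcE z : normc z ^+ 2 = Re z ^+ 2 + Im z ^+ 2.
Proof. by rewrite normcE sqr_sqrtr // addr_ge0 ?sqr_ge0. Qed.

Lemma normcX z n : normc (z ^+ n) = normc z ^+ n.
Proof.
elim: n => [|n IH]; first by rewrite !expr0 ComplexField.Normc.normc1.
by rewrite !exprS ComplexField.Normc.normcM IH.
Qed.

Lemma normc_real (x : R) : normc x%:C = `|x|.
Proof. by rewrite normcE /= expr0n /= addr0 sqrtr_sqr. Qed.

Lemma ler_normc_Re z : `|Re z| <= normc z.
Proof. by rewrite normcE -sqrtr_sqr ler_wsqrtr // lerDl sqr_ge0. Qed.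

Lemma ler_normc_Im z : `|Im z| <= normc z.
Proof. by rewrite normcE -sqrtr_sqr ler_wsqrtr // lerDr sqr_ge0. Qed.

Lemma normc_leD z w : normc (z + w) <= normc z + normc w.
Proof. exact: (@le_normcD R). Qed.

Lemma normc_opp z : normc (- z) = normc z.
Proof. exact: (@normcN R). Qed.

Lemma normc_leB z w : normc (z - w) <= normc z + normc w.
Proof. by rewrite -(normc_opp w) normc_leD. Qed.

Lemma normc_ReIm z : normc z <= `|Re z| + `|Im z|.
Proof.
rewrite normcE -[leRHS]ger0_norm ?addr_ge0 // -sqrtr_sqr ler_wsqrtr //.
by rewrite sqrrD !real_normK ?num_real // lerD2r lerDl mulrn_wge0.
Qed.

Lemma normc_sum n (F : 'I_n -> C) :
  normc (\sum_(i < n) F i) <= \sum_(i < n) normc (F i).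
Proof.
elim: n F => [|n IH] F; first by rewrite !big_ord0 ComplexField.Normc.normc0.
rewrite !big_ord_recr /=; apply: le_trans (normc_leD _ _) _.
by rewrite lerD2r IH.
Qed.

Lemma normc_eq0 z : (normc z == 0) = (z == 0).
Proof.
apply/eqP/eqP => [/ComplexField.Normc.eq0_normc //|->].
exact: ComplexField.Normc.normc0.
Qed.

Lemma normc_gt0 z : (0 < normc z) = (z != 0).
Proof. by rewrite lt0r normc_ge0 andbT normc_eq0. Qed.

Lemma normc_eq0P z : (forall e : R, 0 < e -> normc z <= e) -> z = 0.
Proof.
move=> h; apply/eqP; rewrite -normc_eq0 eq_le normc_ge0 andbT.
by apply/ler_addgt0Pl => e e0; rewrite addr0 h.
Qed.

Lemma complexP z w : Re z = Re w -> Im z = Im w -> z = w.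
Proof. by case: z w => [a b] [c d] /= -> ->. Qed.

End ComplexModulus.

(** * Expansions with geometric remainders, and an identity theorem *)

Section Expansions.
Variable R : realType.
Local Notation C := R[i].

(* [a p] are the coefficients of an expansion of [f p] in powers of [h p], with
   a geometric bound on the remainders that is uniform over [D]; letting the
   coefficients depend on [p] covers integral kernels. *)
Definition expands (T : Type) (D : set T) (h f : T -> C) (a : T -> nat -> C) :=
  exists M B : R, [/\ 0 <= M, 0 <= B,
    forall p n, D p -> normc (a p n) <= M * B ^+ n &
    forall p n, D p ->
      normc (f p - \sum_(k < n) a p k * h p ^+ k) <= M * (B * normc (h p)) ^+ n].

Definition conv (a b : nat -> C) (n : nat) : C := \sum_(i < n.+1) a i * b (n - i)%N.

(** Products of total degree below [n] are sorted by the degree [i] contributed by the first factor,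
    which leaves the range [n - i] to the second. This triangular shape makes the remainder in
    [expandsM] homogeneous of order [n]. *)
Lemma sum_conv (a b : nat -> C) (h : C) n :
  \sum_(k < n) conv a b k * h ^+ k =
  \sum_(i < n) a i * h ^+ i * \sum_(j < n - i) b j * h ^+ j.
Proof.
elim: n => [|n IH]; first by rewrite !big_ord0.
rewrite big_ord_recr /= IH [RHS]big_ord_recr /= subSnn big_ord1 expr0 mulr1.
rewrite [X in _ = X + _](eq_bigr (fun i : 'I_n => a i * h ^+ i * \sum_(j < n - i) b j * h ^+ j +
  a i * b (n - i)%N * h ^+ n)); last first.
  move=> i _; rewrite subSn; last exact: ltnW.
  rewrite big_ord_recr /= mulrDr; congr (_ + _).
  by rewrite mulrACA -exprD subnKC // ltnW.
rewrite big_split /= -addrA; congr (_ + _).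
rewrite /conv big_ord_recr /= subnn mulrDl mulr_suml; congr (_ + _).
by rewrite mulrAC.
Qed.

Lemma expands_widen (T : Type) (D : set T) (h f : T -> C) (a : T -> nat -> C) (M B M' B' : R) :
  M <= M' -> 0 <= B -> B <= B' ->
  (forall p n, D p -> normc (a p n) <= M * B ^+ n) ->
  (forall p n, D p ->
      normc (f p - \sum_(k < n) a p k * h p ^+ k) <= M * (B * normc (h p)) ^+ n) ->
  0 <= M ->
  (forall p n, D p -> normc (a p n) <= M' * B' ^+ n) /\
  (forall p n, D p ->
      normc (f p - \sum_(k < n) a p k * h p ^+ k) <= M' * (B' * normc (h p)) ^+ n).
Proof.
move=> MM B0 BB h1 h2 M0; split => p n Dp.
  apply: le_trans (h1 _ _ Dp) _; rewrite ler_pM ?exprn_ge0 //.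
  by rewrite lerXn2r // nnegrE (le_trans B0).
apply: le_trans (h2 _ _ Dp) _; rewrite ler_pM ?exprn_ge0 ?mulr_ge0 ?normc_ge0 //.
rewrite lerXn2r // ?nnegrE ?mulr_ge0 ?normc_ge0 ?(le_trans B0) //.
by rewrite ler_wpM2r ?normc_ge0.
Qed.

Lemma natr_le_pow2 n : n.+1%:R <= 2 ^+ n :> R.
Proof. by rewrite -natrX ler_nat ltn_expl. Qed.

(** The product minus its truncation is [(f - S_n) g + \sum_i a_i h^i (g - T_(n-i))], with [S] and
    [T] the partial sums of the factors: [n + 1] terms, each at most [M1 M2 (B |h|)^n]. The factor
    [n + 1] is absorbed by doubling [B]. *)
Lemma expandsM T (D : set T) h f g a b :
  expands D h f a -> expands D h g b ->
  expands D h (fun p => f p * g p) (fun p => conv (a p) (b p)).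
Proof.
move=> [M1 [B1 [M10 B10 ha1 hf1]]] [M2 [B2 [M20 B20 ha2 hf2]]].
pose B := Num.max B1 B2.
have B0 : 0 <= B by rewrite le_max B10.
have [|ha hf] := @expands_widen T D h f a M1 B1 M1 B (lexx _) B10 _ ha1 hf1 M10.
  by rewrite le_max lexx.
have [|hb hg] := @expands_widen T D h g b M2 B2 M2 B (lexx _) B20 _ ha2 hf2 M20.
  by rewrite le_max lexx orbT.
have hM n (x : R) : 0 <= x -> n.+1%:R * (M1 * M2 * x ^+ n) <= M1 * M2 * (2 * x) ^+ n.
  move=> x0; rewrite exprMn mulrCA ler_wpM2l ?mulr_ge0 //.
  by rewrite ler_wpM2r ?exprn_ge0 ?natr_le_pow2.
exists (M1 * M2), (2 * B); split; rewrite ?mulr_ge0 //.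
- move=> p n Dp; apply: le_trans (normc_sum _) _.
  apply: (le_trans _ (hM _ _ B0)).
  rewrite -[n.+1 in leRHS]card_ord mulr_natl -sumr_const ler_sum // => i _.
  rewrite ComplexField.Normc.normcM.
  apply: (@le_trans _ _ ((M1 * B ^+ i) * (M2 * B ^+ (n - i)))).
    by rewrite ler_pM ?normc_ge0 ?ha ?hb.
  by rewrite mulrACA -exprD subnKC // -ltnS.
move=> p n Dp; rewrite sum_conv -[2 * B * _]mulrA.
apply: (le_trans _ (hM _ _ (mulr_ge0 B0 (normc_ge0 _)))).
have -> : f p * g p - \sum_(i < n) a p i * h p ^+ i * (\sum_(j < n - i) b p j * h p ^+ j)
  = (f p - \sum_(k < n) a p k * h p ^+ k) * g p +
    \sum_(i < n) a p i * h p ^+ i * (g p - \sum_(j < n - i) b p j * h p ^+ j).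
  under [X in _ = _ + X]eq_bigr do rewrite mulrBr.
  by rewrite big_split /= sumrN -mulr_suml mulrBl addrA subrK.
apply: le_trans (normc_leD _ _) _.
rewrite -natr1 [leRHS]mulrDl mul1r addrC lerD //.
  apply: le_trans (normc_sum _) _.
  rewrite -[n in n%:R]card_ord mulr_natl -sumr_const ler_sum // => i _.
  rewrite !ComplexField.Normc.normcM normcX.
  apply: (@le_trans _ _ ((M1 * B ^+ i * normc (h p) ^+ i) * (M2 * (B * normc (h p)) ^+ (n - i)))).
    rewrite ler_pM ?normc_ge0 ?hg ?mulr_ge0 ?exprn_ge0 ?normc_ge0 //.
    by rewrite ler_wpM2r ?exprn_ge0 ?normc_ge0 ?ha.
  by rewrite -[M1 * _ * _]mulrA -exprMn mulrACA -exprD subnKC // ltnW.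
rewrite ComplexField.Normc.normcM mulrAC.
rewrite ler_pM ?normc_ge0 ?hf //.
have := hg p 0%N Dp; by rewrite big_ord0 subr0 expr0 mulr1.
Qed.

Lemma expandsD T (D : set T) h f g a b :
  expands D h f a -> expands D h g b ->
  expands D h (fun p => f p + g p) (fun p n => a p n + b p n).
Proof.
move=> [M1 [B1 [M10 B10 ha1 hf1]]] [M2 [B2 [M20 B20 ha2 hf2]]].
pose B := Num.max B1 B2.
have B0 : 0 <= B by rewrite le_max B10.
have [|ha hf] := @expands_widen T D h f a M1 B1 M1 B (lexx _) B10 _ ha1 hf1 M10.
  by rewrite le_max lexx.
have [|hb hg] := @expands_widen T D h g b M2 B2 M2 B (lexx _) B20 _ ha2 hf2 M20.
  by rewrite le_max lexx orbT.
exists (M1 + M2), B; split; rewrite ?addr_ge0 //.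
  by move=> p n Dp; rewrite mulrDl; apply: le_trans (normc_leD _ _) _; rewrite lerD ?ha ?hb.
move=> p n Dp; under eq_bigr do rewrite mulrDl.
rewrite big_split /= opprD addrACA mulrDl.
by apply: le_trans (normc_leD _ _) _; rewrite lerD ?hf ?hg.
Qed.

Lemma expands_cst T (D : set T) h (c : C) :
  expands D h (fun=> c) (fun _ n => if n is 0%N then c else 0).
Proof.
exists (normc c), 1; split; rewrite ?normc_ge0 //.
  by move=> p [|n] _; rewrite expr1n mulr1 // ComplexField.Normc.normc0 normc_ge0.
move=> p [|n] _; first by rewrite big_ord0 subr0 expr0 mulr1.
rewrite big_ord_recl /= expr0 mulr1 big1 ?addr0 ?subrr; last by move=> i _; rewrite mul0r.
by rewrite ComplexField.Normc.normc0 mulr_ge0 ?exprn_ge0 ?mul1r ?normc_ge0.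
Qed.

(** If the coefficients before [a n] vanish, the remainder of order [n + 1] at a zero [w] of [f]
    gives [|a n| <= M B^(n+1) |w - w0|], which is arbitrarily small. Once all coefficients vanish,
    [f] equals its remainders of every order, and near [w0] these decrease geometrically. *)
Lemma expands_vanish (D : set C) (w0 : C) (f : C -> C) (a : nat -> C) :
  expands D (fun w => w - w0) f (fun=> a) ->
  (forall d : R, 0 < d -> exists w, [/\ D w, w != w0, normc (w - w0) < d & f w = 0]) ->
  exists2 r : R, 0 < r & forall w, D w -> normc (w - w0) < r -> f w = 0.
Proof.
move=> [M [B [M0 B0 ha hf]]] acc.
have a0 n : a n = 0.
  elim/ltn_ind: n => n IH; apply: normc_eq0P => e e0.
  have K0 : 0 < M * B ^+ n.+1 + 1 by rewrite ltr_wpDl ?mulr_ge0 ?exprn_ge0.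
  have [w [Dw ww0 wd fw]] := acc (e / (M * B ^+ n.+1 + 1)) (divr_gt0 e0 K0).
  have := hf w n.+1 Dw; rewrite fw sub0r normc_opp big_ord_recr /= big1; last first.
    by move=> i _; rewrite IH // mul0r.
  rewrite add0r ComplexField.Normc.normcM normcX exprMn [_ ^+ n.+1 in leRHS]exprSr.
  have h0 : 0 < normc (w - w0) by rewrite normc_gt0 subr_eq0.
  rewrite [in leRHS]exprSr 2!mulrA -[leRHS]mulrA [leRHS]mulrC.
  move: wd; rewrite ltr_pdivlMr // mulrDr mulr1 exprSr => wd.
  have hn : 0 < normc (w - w0) ^+ n by rewrite exprn_gt0.
  set x := normc (w - w0) in hn h0 wd *.
  rewrite [X in _ <= X -> _](_ : _ = (x * (M * (B ^+ n * B))) * x ^+ n); last by ring.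
  rewrite ler_pM2r // => /le_trans; apply.
  by rewrite ltW // (le_lt_trans _ wd) // lerDl ltW.
(* This radius gives [B |w - w0| <= 1/2]; the added 1 covers [B = 0]. *)
exists (2 * B + 1)^-1; first by rewrite invr_gt0 ltr_wpDl ?mulr_ge0.
move=> w Dw; rewrite -[(_ + 1)^-1]mul1r ltr_pdivlMr ?ltr_wpDl ?mulr_ge0 // => hw.
apply: normc_eq0P => e e0.
have Bh : B * normc (w - w0) <= 2^-1.
  rewrite -[2^-1]mul1r ler_pdivlMr // -mulrA mulrC mulrAC -mulrA.
  apply: le_trans (ltW hw); rewrite [B * 2]mulrC ler_wpM2l ?normc_ge0 //.
  by rewrite lerDl.
have [n hn] : exists n : nat, M * 2^-1 ^+ n <= e.
  exists (Num.truncn (M / e)).+1; rewrite exprVn ler_pdivrMr ?exprn_gt0 //.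
  rewrite -ler_pdivrMl // mulrC; apply: (@le_trans _ _ (Num.truncn (M / e)).+1%:R).
    by rewrite ltW // truncnS_gt.
  by apply: le_trans (natr_le_pow2 _); rewrite ler_nat.
apply: le_trans hn.
have := hf w n Dw; rewrite big1 ?subr0; last by move=> i _; rewrite a0 mul0r.
move=> /le_trans; apply; rewrite ler_wpM2l // lerXn2r // nnegrE ?mulr_ge0 ?normc_ge0 //.
Qed.

End Expansions.

(** * Integrals of bounded complex functions against a probability *)

Section ComplexIntegral.
Context d (T : measurableType d) (R : realType) (mu : probability T R).
Local Notation C := R[i].
Implicit Types f g : T -> C.

Definition cint f : C := (\int[mu]_t Re (f t)) +i* (\int[mu]_t Im (f t)).

(** Over a probability space boundedness gives integrability and, unlike integrability, it passes to
    products, as the expansion coefficients require. *)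
Definition cbounded f :=
  [/\ measurable_fun [set: T] (fun t => Re (f t)),
      measurable_fun [set: T] (fun t => Im (f t)) &
      exists M : R, forall t, normc (f t) <= M].

Lemma cbounded_cst (c : C) : cbounded (fun=> c).
Proof.
by split; [exact: measurable_cst|exact: measurable_cst|exists (normc c)].
Qed.

Lemma cboundedD f g : cbounded f -> cbounded g -> cbounded (fun t => f t + g t).
Proof.
move=> [mf1 mf2 [M hM]] [mg1 mg2 [M' hM']]; split.
- rewrite [X in measurable_fun _ X](_ : _ = (fun t => Re (f t)) \+ (fun t => Re (g t))).
    exact: measurable_funD.
  by apply/funext => t /=; case: (f t) (g t) => [? ?] [? ?].
- rewrite [X in measurable_fun _ X](_ : _ = (fun t => Im (f t)) \+ (fun t => Im (g t))).
    exact: measurable_funD.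
  by apply/funext => t /=; case: (f t) (g t) => [? ?] [? ?].
- by exists (M + M') => t; apply: le_trans (normc_leD _ _) _; rewrite lerD.
Qed.

Lemma cboundedM f g : cbounded f -> cbounded g -> cbounded (fun t => f t * g t).
Proof.
move=> [mf1 mf2 [M hM]] [mg1 mg2 [M' hM']]; split.
- rewrite [X in measurable_fun _ X](_ : _ = (fun t => Re (f t)) \* (fun t => Re (g t)) \-
    ((fun t => Im (f t)) \* (fun t => Im (g t)))).
    by apply: measurable_funB; exact: measurable_funM.
  by apply/funext => t /=; case: (f t) (g t) => [? ?] [? ?].
- rewrite [X in measurable_fun _ X](_ : _ = (fun t => Re (f t)) \* (fun t => Im (g t)) \+
    ((fun t => Im (f t)) \* (fun t => Re (g t)))).
    by apply: measurable_funD; exact: measurable_funM.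
  by apply/funext => t /=; case: (f t) (g t) => [? ?] [? ?].
- exists (M * M') => t; rewrite ComplexField.Normc.normcM.
  by rewrite ler_pM ?normc_ge0.
Qed.

Lemma cboundedX f n : cbounded f -> cbounded (fun t => f t ^+ n).
Proof.
move=> bf; elim: n => [|n IH]; first exact: cbounded_cst.
rewrite (_ : (fun _ => _) = (fun t => f t * f t ^+ n)); first exact: cboundedM.
by apply/funext => t; rewrite exprS.
Qed.

Lemma cbounded_sum n (F : nat -> T -> C) :
  (forall i, cbounded (F i)) -> cbounded (fun t => \sum_(i < n) F i t).
Proof.
move=> bF; elim: n => [|n IH].
  rewrite (_ : (fun _ => _) = fun=> 0); first exact: cbounded_cst.
  by apply/funext => t; rewrite big_ord0.
rewrite (_ : (fun _ => _) = (fun t => \sum_(i < n) F i t + F n t)); first exact: cboundedD.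
by apply/funext => t; rewrite big_ord_recr.
Qed.

Lemma cbounded_integrable f : cbounded f ->
  mu.-integrable [set: T] (EFin \o (fun t => Re (f t))) /\
  mu.-integrable [set: T] (EFin \o (fun t => Im (f t))).
Proof.
move=> [m1 m2 [M hM]].
have muT : (mu [set: T] < +oo)%E by rewrite probability_setT ltry.
split; apply: measurable_bounded_integrable => //; exists M; split; rewrite ?num_real //.
  move=> K MK t _ /=; apply: le_trans (ler_normc_Re _) _.
  by rewrite (le_trans (hM t)) // ltW.
move=> K MK t _ /=; apply: le_trans (ler_normc_Im _) _.
by rewrite (le_trans (hM t)) // ltW.
Qed.

Lemma cintD f g : cbounded f -> cbounded g ->
  cint (fun t => f t + g t) = cint f + cint g.
Proof.
move=> /cbounded_integrable[if1 if2] /cbounded_integrable[ig1 ig2].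
apply: complexP; rewrite /= -RintegralD //; apply: eq_Rintegral => t _;
  by case: (f t) (g t) => [? ?] [? ?].
Qed.

Lemma cintZ (z : C) f : cbounded f -> cint (fun t => z * f t) = z * cint f.
Proof.
move=> /cbounded_integrable[if1 if2]; case: z => a b.
have iz (r : R) (h : T -> R) : mu.-integrable [set: T] (EFin \o h) ->
    mu.-integrable [set: T] (EFin \o (fun t => r * h t)).
  by move=> ih; have := integrableZl measurableT r ih.
apply: complexP; rewrite /= -!RintegralZl // -?RintegralD -?RintegralB //; try exact: iz;
  by apply: eq_Rintegral => t _; case: (f t) => [? ?].
Qed.

Lemma cintB f g : cbounded f -> cbounded g ->
  cint (fun t => f t - g t) = cint f - cint g.
Proof.
move=> bf bg; rewrite -mulN1r -cintZ // -cintD //.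
  by congr cint; apply/funext => t; rewrite mulN1r.
by apply: cboundedM => //; exact: cbounded_cst.
Qed.

Lemma cint_sum n (F : nat -> T -> C) : (forall i, cbounded (F i)) ->
  cint (fun t => \sum_(i < n) F i t) = \sum_(i < n) cint (F i).
Proof.
move=> bF; elim: n => [|n IH].
  rewrite big_ord0 (_ : (fun _ => _) = fun=> 0 * 0); last first.
    by apply/funext => t; rewrite big_ord0 mul0r.
  by rewrite cintZ ?mul0r //; exact: cbounded_cst.
rewrite big_ord_recr /= -IH -cintD //; last exact: cbounded_sum.
by congr cint; apply/funext => t; rewrite big_ord_recr.
Qed.

Lemma Rintegral_le_bound (h : T -> R) (M : R) : (forall t, `|h t| <= M) ->
  mu.-integrable [set: T] (EFin \o h) -> `|\int[mu]_t h t| <= M.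
Proof.
move=> hM ih; apply: le_trans (le_normr_Rintegral _ ih) _ => //.
have ic : mu.-integrable [set: T] (EFin \o cst M).
  have muT : (mu [set: T] < +oo)%E by rewrite probability_setT ltry.
  apply: measurable_bounded_integrable => //.
  exists M; split; rewrite ?num_real // => K MK t _ /=.
  by rewrite ger0_norm ?(ltW MK) //; exact: le_trans (normr_ge0 _) (hM t).
apply: (@le_trans _ _ (\int[mu]_(t in setT) M)).
  apply: le_Rintegral => //.
  exact: integrable_norm ih.
rewrite Rintegral_cst // (_ : fine _ = 1) ?mulr1 //.
exact: (congr1 fine (probability_setT mu)).
Qed.

(** The factor 2 comes from bounding the real and imaginary parts separately; it is absorbed by the
    constant [M] of an expansion. *)
Lemma cint_le f (M : R) : cbounded f -> (forall t, normc (f t) <= M) ->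
  normc (cint f) <= 2 * M.
Proof.
move=> /cbounded_integrable[if1 if2] hM.
apply: le_trans (normc_ReIm _) _; rewrite mulr_natl mulr2n /= lerD //.
  by apply: Rintegral_le_bound => // t; apply: le_trans (ler_normc_Re _) _.
by apply: Rintegral_le_bound => // t; apply: le_trans (ler_normc_Im _) _.
Qed.

(** A remainder bound uniform in both variables survives integration in [t], and only [M] doubles.
    The expansion variable [h] does not depend on [t], so its powers leave the integral. *)
Lemma expands_cint (W : Type) (D : set W) (h : W -> C) (f : W -> T -> C)
    (a : T -> nat -> C) :
  (forall w, D w -> cbounded (f w)) -> (forall n, cbounded (a ^~ n)) ->
  (exists w, D w) ->
  expands [set p : W * T | D p.1] (fun p => h p.1) (fun p => f p.1 p.2) (fun p => a p.2) ->
  expands D h (fun w => cint (f w)) (fun _ n => cint (a ^~ n)).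
Proof.
move=> bf ba [w0 Dw0] [M [B [M0 B0 ha hf]]].
exists (2 * M), B; split; rewrite ?mulr_ge0 //.
  by move=> w n Dw; rewrite -mulrA; apply: cint_le => // t; exact: (ha (w0, t)).
move=> w n Dw.
have bs i : cbounded (fun t => h w ^+ i * a t i).
  by apply: cboundedM => //; exact: cbounded_cst.
have -> : \sum_(k < n) cint (a ^~ k) * h w ^+ k =
    cint (fun t => \sum_(k < n) h w ^+ k * a t k).
  rewrite (cint_sum n (F := fun i t => h w ^+ i * a t i)) //.
  by apply: eq_bigr => i _; rewrite cintZ // mulrC.
rewrite -cintB //; [|exact: bf|exact: (cbounded_sum n (F := fun i t => h w ^+ i * a t i))].
rewrite -mulrA; apply: cint_le.
  apply: cboundedD; first exact: bf.
  rewrite (_ : (fun _ => _) = (fun t => -1 * \sum_(k < n) h w ^+ k * a t k)); last first.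
    by apply/funext => t; rewrite mulN1r.
  apply: cboundedM; first exact: cbounded_cst.
  exact: (cbounded_sum n (F := fun i t => h w ^+ i * a t i)).
move=> t; have := hf (w, t) n Dw; rewrite /=.
by under eq_bigr do rewrite mulrC.
Qed.

End ComplexIntegral.

(** * The Cauchy transform on the upper half-plane *)

Section CauchyTransform.
Variable R : realType.
Local Notation C := R[i].

Lemma Re_invc (z : C) : Re z^-1 = Re z / (Re z ^+ 2 + Im z ^+ 2).
Proof. by case: z. Qed.

Lemma Im_invc (z : C) : Im z^-1 = - Im z / (Re z ^+ 2 + Im z ^+ 2).
Proof. by case: z => a b /=; rewrite mulNr. Qed.

Lemma Im_shift (z : C) (t : R) : Im (z - t%:C) = Im z.
Proof. by case: z => a b /=; rewrite oppr0 addr0. Qed.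

Lemma Re_shift (z : C) (t : R) : Re (z - t%:C) = Re z - t.
Proof. by case: z. Qed.

Lemma Im_gt0_neq0 (z : C) : 0 < Im z -> z != 0.
Proof. by move=> z0; apply: contraTneq z0 => ->; rewrite ltxx. Qed.

Lemma normc_kernel_le (y : R) (z : C) (t : R) :
  0 < y -> y <= Im z -> normc (z - t%:C)^-1 <= y^-1.
Proof.
move=> y0 yz; rewrite ComplexField.Normc.normcV lef_pV2 ?posrE //.
  apply: le_trans (ler_normc_Im _); rewrite Im_shift ger0_norm //.
  exact: le_trans (ltW y0) yz.
by rewrite normc_gt0 Im_gt0_neq0 // Im_shift (lt_le_trans y0).
Qed.

Lemma ReIm_kernel_gt0 (z : C) (t : R) : 0 < Im z ->
  0 < (Re z - t) ^+ 2 + Im z ^+ 2.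
Proof. by move=> z0; rewrite ltr_wpDl ?sqr_ge0 ?exprn_gt0. Qed.

Lemma measurable_kernel (z : C) : 0 < Im z ->
  measurable_fun [set: measurableTypeR R] (fun t : R => Re (z - t%:C)^-1) /\
  measurable_fun [set: measurableTypeR R] (fun t : R => Im (z - t%:C)^-1).
Proof.
move=> z0.
have cn : continuous (fun t : R => ((Re z - t) ^+ 2 + Im z ^+ 2)^-1).
  move=> t; apply: cvgV; first by rewrite gt_eqF // ReIm_kernel_gt0.
  apply: cvgD; last exact: cvg_cst.
  have : (fun t : R => Re z - t) t0 @[t0 --> t] --> Re z - t.
    by apply: cvgB; [exact: cvg_cst|exact: cvg_id].
  by move=> h; under eq_fun do rewrite expr2; rewrite expr2; exact: cvgM.
split; apply: continuous_measurable_fun.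
  rewrite (_ : (fun _ => _) = (fun t => (Re z - t) * ((Re z - t) ^+ 2 + Im z ^+ 2)^-1)).
    move=> t; apply: cvgM; last exact: cn.
    by apply: cvgB; [exact: cvg_cst|exact: cvg_id].
  by apply/funext => t; rewrite Re_invc Re_shift Im_shift.
rewrite (_ : (fun _ => _) = (fun t => - Im z * ((Re z - t) ^+ 2 + Im z ^+ 2)^-1)).
  by move=> t; apply: cvgM; [exact: cvg_cst|exact: cn].
by apply/funext => t; rewrite Im_invc Re_shift Im_shift.
Qed.

Lemma cbounded_kernel (z : C) : 0 < Im z ->
  @cbounded _ (measurableTypeR R) R (fun t => (z - t%:C)^-1).
Proof.
move=> z0; have [m1 m2] := measurable_kernel z0; split => //.
by exists (Im z)^-1 => t; apply: normc_kernel_le.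
Qed.

(** The radius is half the distance to the real axis, so that [|w - t| >= Im w0 / 2] for every real
    [t] and the kernel can be expanded uniformly in [t]. *)
Definition half_disc (w0 : C) : set C := [set w | normc (w - w0) <= Im w0 / 2].

Lemma half_disc_Im (w0 w : C) : half_disc w0 w -> Im w0 / 2 <= Im w.
Proof.
rewrite /half_disc /= => h.
have := le_trans (ler_normc_Im (w - w0)) h.
have -> : Im (w - w0) = Im w - Im w0 by case: w w0 {h} => ? ? [? ?].
rewrite ler_norml => /andP[h1 _]; lra.
Qed.

Lemma half_disc_center (w0 : C) : 0 < Im w0 -> half_disc w0 w0.
Proof.
by move=> h; rewrite /half_disc /= subrr ComplexField.Normc.normc0 divr_ge0 // ltW.
Qed.

Lemma half_disc_gt0 (w0 w : C) : 0 < Im w0 -> half_disc w0 w -> 0 < Im w.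
Proof. by move=> h /half_disc_Im; apply: lt_le_trans; rewrite divr_gt0. Qed.

(** A finite geometric series: the remainder is exactly [(- (w - w0) / (w0 - t))^n / (w - t)], and
    [|w0 - t| >= Im w0] makes it geometric with ratio [|w - w0| / Im w0]. *)
Lemma expands_kernel (w0 : C) : 0 < Im w0 ->
  expands [set p : C * R | half_disc w0 p.1] (fun p => p.1 - w0)
    (fun p => (p.1 - p.2%:C)^-1) (fun p n => (-1) ^+ n * (w0 - p.2%:C)^-1 ^+ n.+1).
Proof.
move=> w00; have h2 : 0 < Im w0 / 2 by rewrite divr_gt0.
exists (2 / Im w0), (Im w0)^-1; split; rewrite ?divr_ge0 ?invr_ge0 // ?ltW //.
  move=> [w t] n /= hw.
  rewrite ComplexField.Normc.normcM !normcX normc_opp ComplexField.Normc.normc1.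
  rewrite expr1n mul1r exprS; apply: ler_pM; rewrite ?exprn_ge0 ?normc_ge0 //.
    apply: (@le_trans _ _ (Im w0)^-1); first exact: normc_kernel_le.
    by rewrite ler_peMl ?invr_ge0 ?ltW // (ltr_nat _ 1 2).
  by apply: lerXn2r; rewrite ?nnegrE ?normc_ge0 ?invr_ge0 ?(ltW w00) // normc_kernel_le.
move=> [w t] n /= hw.
have wt : w - t%:C != 0 by rewrite Im_gt0_neq0 // Im_shift (half_disc_gt0 w00).
have w0t : w0 - t%:C != 0 by rewrite Im_gt0_neq0 // Im_shift.
have -> : (w - t%:C)^-1 - \sum_(k < n) (-1) ^+ k * (w0 - t%:C)^-1 ^+ k.+1 * (w - w0) ^+ k
   = (- (w - w0)) ^+ n * (w0 - t%:C)^-1 ^+ n * (w - t%:C)^-1.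
  elim: n => [|n IH]; first by rewrite big_ord0 !expr0 !mul1r subr0.
  rewrite big_ord_recr /= opprD addrA IH.
  rewrite [(- (w - w0)) ^+ n]exprNn.
  have e1 : (w - t%:C)^-1 = (w0 - t%:C)^-1 - (w - w0) * (w0 - t%:C)^-1 * (w - t%:C)^-1.
    by field; rewrite wt w0t.
  rewrite [in LHS]e1 ![_ ^+ n.+1]exprS [(- (w - w0)) ^+ n]exprNn.
  by ring.
rewrite !ComplexField.Normc.normcM !normcX normc_opp -exprMn mulrC.
apply: ler_pM; rewrite ?exprn_ge0 ?normc_ge0 ?mulr_ge0 ?normc_ge0 //.
  by rewrite -invf_div normc_kernel_le // half_disc_Im.
apply: lerXn2r; rewrite ?nnegrE ?mulr_ge0 ?normc_ge0 ?invr_ge0 ?(ltW w00) //.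
by rewrite mulrC ler_wpM2r ?normc_ge0 // normc_kernel_le.
Qed.

Variable mu : probability (measurableTypeR R) R.
Local Notation G := (cauchy_transform mu).

(** The derivative of [G] under the integral sign; that it is the derivative is the content of
    [dcauchyP]. *)
Definition dcauchy (z : C) : C := - cint mu (fun t : R => (z - t%:C)^-1 ^+ 2).
Local Notation G' := dcauchy.

Lemma cauchy_cint z : G z = cint mu (fun t : R => (z - t%:C)^-1).
Proof. by []. Qed.

Lemma cauchy_expands (w0 : C) : 0 < Im w0 ->
  expands (half_disc w0) (fun w => w - w0) G
    (fun _ n => cint mu (fun t : R => (-1) ^+ n * (w0 - t%:C)^-1 ^+ n.+1)).
Proof.
move=> w00; apply: (@expands_cint _ _ _ mu C (half_disc w0) (fun w => w - w0)
  (fun w t => (w - t%:C)^-1) (fun t n => (-1) ^+ n * (w0 - t%:C)^-1 ^+ n.+1)).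
- by move=> w hw; apply: cbounded_kernel; exact: half_disc_gt0 hw.
- move=> n; apply: cboundedM; first exact: cbounded_cst.
  by apply: cboundedX; exact: cbounded_kernel.
- by exists w0; exact: half_disc_center.
- exact: expands_kernel.
Qed.

Lemma dcauchy_expands (w0 : C) : 0 < Im w0 ->
  exists a, expands (half_disc w0) (fun w => w - w0) G' (fun _ => a).
Proof.
move=> w00; pose a (t : R) (n : nat) := (-1) ^+ n * (w0 - t%:C)^-1 ^+ n.+1.
have ba n : @cbounded _ (measurableTypeR R) R (a ^~ n).
  apply: cboundedM; first exact: cbounded_cst.
  by apply: cboundedX; exact: cbounded_kernel.
have h := @expands_cint _ (measurableTypeR R) R mu C (half_disc w0) (fun w => w - w0)
  (fun w t => (w - t%:C)^-1 * (w - t%:C)^-1) (fun t => conv (a t) (a t)).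
exists (conv (fun n : nat => if n is 0%N then -1 else 0)
  (fun n => cint mu (fun t : measurableTypeR R => conv (a t) (a t) n))).
rewrite (_ : G' = fun w => -1 * cint mu (fun t : R => (w - t%:C)^-1 * (w - t%:C)^-1)).
  apply: (expandsM (expands_cst (half_disc w0) (fun w => w - w0) (-1))); apply: h.
  - by move=> w hw; apply: cboundedM; apply: cbounded_kernel; exact: half_disc_gt0 hw.
  - move=> n; apply: (@cbounded_sum _ (measurableTypeR R) R n.+1
      (fun i t => a t i * a t (n - i)%N)) => i.
    exact: cboundedM.
  - by exists w0; exact: half_disc_center.
  - by apply: expandsM; exact: expands_kernel.
by apply/funext => w; rewrite mulN1r.
Qed.

(** This is the expansion of [G] at order 2, whose coefficients of degree 0 and 1 are [G w0] and
    [G' w0]. *)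
Lemma dcauchyP (w0 : C) : 0 < Im w0 ->
  exists K : R, 0 <= K /\ forall w, half_disc w0 w ->
    normc (G w - G w0 - G' w0 * (w - w0)) <= K * normc (w - w0) ^+ 2.
Proof.
move=> w00; have [M [B [M0 B0 _ hf]]] := cauchy_expands w00.
exists (M * B ^+ 2); split; first by rewrite mulr_ge0 ?exprn_ge0.
move=> w hw; rewrite -mulrA -exprMn; apply: le_trans _ (hf w 2%N hw).
rewrite big_ord_recl big_ord1 expr0 mulr1 expr1.
rewrite (_ : cint mu (fun t => _ * _ ^+ (@ord0 1).+1) = G w0); last first.
  by rewrite cauchy_cint; congr cint; apply/funext => t; rewrite mul1r expr1.
rewrite (_ : cint mu (fun t => _ * _) = G' w0); first by rewrite opprD addrA.
rewrite [RHS]/dcauchy -[RHS]mulN1r -cintZ; last by apply: cboundedX; exact: cbounded_kernel.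
by congr cint; apply/funext.
Qed.

(** The kernel has negative imaginary part at every [t]. A nonnegative integral would force the
    integral of its absolute value to vanish, hence the kernel to vanish almost everywhere, and the
    whole line would be a null set. *)
Lemma Im_cauchy_lt0 (z : C) : 0 < Im z -> Im (G z) < 0.
Proof.
move=> z0; rewrite cauchy_cint /=.
have [_ if2] := cbounded_integrable mu (cbounded_kernel z0).
pose f (t : R) := Im z / ((Re z - t) ^+ 2 + Im z ^+ 2).
have fE t : Im (z - t%:C)^-1 = - f t.
  by rewrite Im_invc Re_shift Im_shift mulNr.
have f0 t : 0 < f t by rewrite divr_gt0 // ReIm_kernel_gt0.
pose g (t : R) := Im (z - t%:C)^-1.
rewrite ltNge; apply/negP => I0.
have ig : mu.-integrable [set: measurableTypeR R] (EFin \o (fun t => `|g t|)).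
  exact: integrable_norm if2.
have Ig : \int[mu]_t `|g t| = - \int[mu]_t g t.
  rewrite -mulN1r -RintegralZl //; apply: eq_Rintegral => t _.
  by rewrite /g fE normrN mulN1r opprK gtr0_norm.
have Ig0 : \int[mu]_t `|g t| = 0.
  apply/eqP; rewrite eq_le {1}Ig oppr_le0 I0 /=.
  by apply: Rintegral_ge0 => t _.
have Ie0 : (\int[mu]_t `|(EFin \o g) t| = 0)%E.
  have := integrable_fin_num measurableT ig => /fineK <-.
  exact: (congr1 EFin Ig0).
have [mg1 mg2] := measurable_kernel z0.
have mg : measurable_fun [set: measurableTypeR R] (EFin \o g) by exact/measurable_EFinP.
have [N [mN N0 sN]] := (ae_eq_integral_abs mu measurableT mg).1 Ie0.
have NT : N = setT.
  apply/seteqP; split => // t _; apply: sN => /= /(_ I) [].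
  by rewrite /g fE => /eqP; rewrite oppr_eq0 gt_eqF.
have := probability_setT mu; rewrite -NT; move: N0 => /= -> /eqP.
by rewrite eq_sym onee_eq0.
Qed.

End CauchyTransform.

(** * Rules for real derivatives *)

Section RealDerivatives.
Variable R : realType.
Implicit Types (f g : R -> R) (x : R).

Lemma der_ext f g x (d d' : R) : is_derive x 1 f d -> f =1 g -> d = d' ->
  is_derive x 1 g d'.
Proof. by move=> h /funext <- <-. Qed.

Lemma der_near f g x (d : R) : (\forall y \near x, f y = g y) ->
  is_derive x 1 f d -> is_derive x 1 g d.
Proof.
move=> fg h; apply: (@near_eq_is_derive R R R f g x 1 d) => //; exact: oner_neq0.
Qed.

Lemma derD f g x (a b : R) : is_derive x 1 f a -> is_derive x 1 g b ->
  is_derive x 1 (fun y => f y + g y) (a + b).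
Proof. by move=> h1 h2; apply: der_ext (is_deriveD h1 h2) _ _. Qed.

Lemma derB f g x (a b : R) : is_derive x 1 f a -> is_derive x 1 g b ->
  is_derive x 1 (fun y => f y - g y) (a - b).
Proof. by move=> h1 h2; apply: der_ext (is_deriveB h1 h2) _ _. Qed.

Lemma derM f g x (a b : R) : is_derive x 1 f a -> is_derive x 1 g b ->
  is_derive x 1 (fun y => f y * g y) (a * g x + f x * b).
Proof.
move=> h1 h2; apply: der_ext (is_deriveM h1 h2) _ _ => //.
by rewrite addrC mulrC.
Qed.

Lemma derMl (k : R) f x (a : R) : is_derive x 1 f a ->
  is_derive x 1 (fun y => k * f y) (k * a).
Proof.
move=> h; apply: der_ext (derM (is_derive_cst k x 1) h) _ _ => //=.
by rewrite mul0r add0r.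
Qed.

Lemma derV f x (a : R) : f x != 0 -> is_derive x 1 f a ->
  is_derive x 1 (fun y => (f y)^-1) (- a / f x ^+ 2).
Proof.
move=> f0 h; apply: der_ext (is_deriveV f0 h) _ _ => //.
by rewrite /GRing.scale /= mulNr mulNr mulrC.
Qed.

Lemma der_id x : is_derive x 1 (fun y : R => y) 1.
Proof. exact: is_derive_id. Qed.

Lemma der_cst (k : R) x : is_derive x 1 (fun=> k) 0.
Proof. exact: is_derive_cst. Qed.

Lemma der_comp f g x (a b : R) : is_derive (g x) 1 f a -> is_derive x 1 g b ->
  is_derive x 1 (fun y => f (g y)) (a * b).
Proof. exact: is_derive1_comp. Qed.

Lemma derX f x (a : R) n : is_derive x 1 f a ->
  is_derive x 1 (fun y => f y ^+ n.+1) (n.+1%:R * f x ^+ n * a).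
Proof.
move=> h; elim: n => [|n IH]; first by apply: der_ext h _ _; rewrite ?expr0 ?mul1r.
apply: der_ext (derM h IH) _ _ => [y|]; first by rewrite -exprS.
rewrite [in RHS]exprS -natr1 exprS; ring.
Qed.

Lemma der_continuous f x (a : R) : is_derive x 1 f a -> {for x, continuous f}.
Proof. by move=> h; apply: differentiable_continuous; apply/derivable1_diffP; case: h. Qed.

Lemma der_within_continuous f (df : R -> R) (a b : R) :
  (forall x, a <= x <= b -> is_derive x 1 f (df x)) -> {within `[a, b], continuous f}.
Proof.
move=> h; apply: continuous_in_subspaceT => x; rewrite inE /= in_itv /= => /h.
exact: der_continuous.
Qed.

(** Squared increments of differentiable functions, divided by the step, tend to 0. This turns the
    second-order remainder of [G] into a derivative along curves. *)
Lemma der_squeeze f g h x (K a b : R) :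
  is_derive x 1 g a -> is_derive x 1 h b ->
  (\forall y \near x, `|f y - f x| <= K * ((g y - g x) ^+ 2 + (h y - h x) ^+ 2)) ->
  is_derive x 1 f 0.
Proof.
move=> hg hh hf.
have cg := der_continuous hg; have ch := der_continuous hh.
have sh : (e *: 1 + x : R) @[e --> (0 : R)^'] --> x.
  rewrite (_ : (fun e => _) = (fun e : R => e + x)); last first.
    by apply/funext => e; rewrite /GRing.scale /= mulr1.
  have : (e + x : R) @[e --> (0 : R)] --> 0 + x.
    by apply: cvgD; [exact: cvg_id|exact: cvg_cst].
  rewrite add0r; exact: cvg_within_filter.
(* Difference quotient times increment: in the limit, [c] times 0. *)
have q (k : R -> R) (c : R) : is_derive x 1 k c -> {for x, continuous k} ->
    e^-1 * (k (e *: 1 + x) - k x) ^+ 2 @[e --> (0 : R)^'] --> 0.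
  move=> [dk kc] ck; have c0 : c * 0 = 0 :> R by rewrite mulr0.
  suff : e^-1 * (k (e *: 1 + x) - k x) ^+ 2 @[e --> (0 : R)^'] --> c * 0 by rewrite c0.
  under eq_fun do rewrite expr2 mulrA.
  apply: cvgM; first by rewrite -kc; exact: dk.
  have kl : k (e *: 1 + x) @[e --> (0 : R)^'] --> k x by exact: (cvg_comp _ _ sh ck).
  have := cvgB kl (cvg_cst (k x)); rewrite subrr; exact.
have lim0 : (e^-1 *: (f (e *: 1 + x) - f x) : R) @[e --> (0 : R)^'] --> (0 : R).
  apply/norm_cvg0P.
  apply: (@squeeze_cvgr _ _ _ _ (fun=> 0) (fun e => `|K| *
     `|e^-1 * (g (e *: 1 + x) - g x) ^+ 2 + e^-1 * (h (e *: 1 + x) - h x) ^+ 2|)).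
  - near=> e.
    have he : `|f (e *: 1 + x) - f x| <= K * ((g (e *: 1 + x) - g x) ^+ 2 + (h (e *: 1 + x) - h x) ^+ 2).
      by near: e; exact: (sh _ hf).
    rewrite normr_ge0 /=.
    rewrite -mulrDr normrM normfV normrM normfV mulrCA ler_wpM2l ?invr_ge0 //.
    apply: le_trans he _; rewrite -normrM ler_norm //.
  - exact: cvg_cst.
  - have := cvgM (cvg_cst `|K|) (cvg_norm (cvgD (q _ _ hg cg) (q _ _ hh ch))).
    by rewrite addr0 normr0 mulr0; apply.
split; first by apply/cvg_ex; exists 0; exact: lim0.
by apply: cvg_lim => //; exact: lim0.
Unshelve. all: by end_near.
Qed.

End RealDerivatives.

(** * Differentiation of complex curves with a real parameter *)

Section ComplexCurves.
Variable R : realType.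
Local Notation C := R[i].
Implicit Types (f g : R -> C) (x : R).

Definition cder f x (d : C) :=
  is_derive x 1 (fun s => Re (f s)) (Re d) /\
  is_derive x 1 (fun s => Im (f s)) (Im d).

Lemma ReD (z w : C) : Re (z + w) = Re z + Re w.
Proof. by case: z w => [? ?] [? ?]. Qed.
Lemma ImD (z w : C) : Im (z + w) = Im z + Im w.
Proof. by case: z w => [? ?] [? ?]. Qed.
Lemma ReN (z : C) : Re (- z) = - Re z.
Proof. by case: z. Qed.
Lemma ImN (z : C) : Im (- z) = - Im z.
Proof. by case: z. Qed.
Lemma ReM (z w : C) : Re (z * w) = Re z * Re w - Im z * Im w.
Proof. by case: z w => [? ?] [? ?]. Qed.
Lemma ImM (z w : C) : Im (z * w) = Re z * Im w + Im z * Re w.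
Proof. by case: z w => [? ?] [? ?]. Qed.

Lemma cder_ext f g x (d d' : C) : cder f x d -> f =1 g -> d = d' -> cder g x d'.
Proof. by move=> h /funext <- <-. Qed.

Lemma cder_unique f x (d d' : C) : cder f x d -> cder f x d' -> d = d'.
Proof.
by move=> [[_ a1] [_ a2]] [[_ b1] [_ b2]]; apply: complexP; rewrite -?a1 -?a2.
Qed.

Lemma cder_near f g x (d : C) : (\forall y \near x, f y = g y) ->
  cder f x d -> cder g x d.
Proof.
move=> h [h1 h2]; split.
  by apply: der_near h1; apply: filterS h => y ->.
by apply: der_near h2; apply: filterS h => y ->.
Qed.

Lemma cder_cst (k : C) x : cder (fun=> k) x 0.
Proof. by split; exact: der_cst. Qed.

Lemma cderD f g x (a b : C) : cder f x a -> cder g x b ->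
  cder (fun y => f y + g y) x (a + b).
Proof.
move=> [f1 f2] [g1 g2]; split; [apply: der_ext (derD f1 g1) _ _|apply: der_ext (derD f2 g2) _ _];
  by move=> *; rewrite ?ReD ?ImD.
Qed.

Lemma cderM f g x (a b : C) : cder f x a -> cder g x b ->
  cder (fun y => f y * g y) x (a * g x + f x * b).
Proof.
move=> [f1 f2] [g1 g2]; split.
  apply: der_ext (derB (derM f1 g1) (derM f2 g2)) _ _ => [y|]; first by rewrite ReM.
  by rewrite ReD !ReM; ring.
apply: der_ext (derD (derM f1 g2) (derM f2 g1)) _ _ => [y|]; first by rewrite ImM.
by rewrite ImD !ImM; ring.
Qed.

Lemma cderMl (k : C) f x (a : C) : cder f x a -> cder (fun y => k * f y) x (k * a).
Proof.
by move=> h; apply: cder_ext (cderM (cder_cst k x) h) _ _ => //; rewrite mul0r add0r.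
Qed.

Lemma cderB f g x (a b : C) : cder f x a -> cder g x b ->
  cder (fun y => f y - g y) x (a - b).
Proof.
move=> hf hg; apply: cder_ext (cderD hf (cderMl (-1) hg)) _ _ => [y|]; by rewrite mulN1r.
Qed.

Lemma cder_real (h : R -> R) x (a : R) : is_derive x 1 h a ->
  cder (fun y => (h y)%:C) x a%:C.
Proof. by move=> ha; split => //=; exact: der_cst. Qed.

Lemma sqr_ReIm_neq0 (z : C) : z != 0 -> Re z ^+ 2 + Im z ^+ 2 != 0.
Proof.
by move=> z0; rewrite -sqr_normcE expf_eq0 /= normc_eq0.
Qed.

Lemma cderV f x (a : C) : f x != 0 -> cder f x a ->
  cder (fun y => (f y)^-1) x (- a / f x ^+ 2).
Proof.
move=> f0 [f1 f2].
have n0 := sqr_ReIm_neq0 f0.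
have dn := derV (f := fun y => Re (f y) ^+ 2 + Im (f y) ^+ 2) n0 (derD (derX 1 f1) (derX 1 f2)).
have fx : (f x ^+ 2)^-1 = (f x)^-1 * (f x)^-1 by rewrite -exprVn expr2.
split.
  apply: der_ext (derM f1 dn) _ _ => [y|]; first by rewrite Re_invc.
  by rewrite fx ReM ReN ImN ReM ImM Re_invc Im_invc !expr1; field.
apply: der_ext (derMl (-1) (derM f2 dn)) _ _ => [y|]; first by rewrite Im_invc; ring.
by rewrite fx ImM ReN ImN ReM ImM Re_invc Im_invc !expr1; field.
Qed.

Lemma half_disc_near (f : R -> C) x (a : C) : 0 < Im (f x) -> cder f x a ->
  \forall y \near x, half_disc (f x) (f y).
Proof.
move=> f0 [h1 h2].
have c1 := der_continuous h1; have c2 := der_continuous h2.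
have e0 : 0 < Im (f x) / 4 by rewrite divr_gt0.
near=> y.
rewrite /half_disc /=; apply: le_trans (normc_ReIm _) _.
rewrite ReD ReN ImD ImN.
have : `|Re (f y) - Re (f x)| < Im (f x) / 4.
  by near: y; apply: cvgr_distC_lt => //; exact: c1.
have : `|Im (f y) - Im (f x)| < Im (f x) / 4.
  by near: y; apply: cvgr_distC_lt => //; exact: c2.
set u := `|_|; set v := `|_|; lra.
Unshelve. all: by end_near.
Qed.

(** Subtracting the linear part [G' (f x) f] leaves a curve whose increments are quadratic in those
    of [f], hence with derivative 0 at [x] by [der_squeeze]. *)
Lemma cder_cauchy (mu : probability (measurableTypeR R) R) f x (a : C) :
  0 < Im (f x) -> cder f x a ->
  cder (fun y => cauchy_transform mu (f y)) x (dcauchy mu (f x) * a).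
Proof.
move=> f0 fa; have [h1 h2] := fa; have [K [K0 hK]] := dcauchyP mu f0.
pose g y := cauchy_transform mu (f y) - dcauchy mu (f x) * f y.
have gK y : half_disc (f x) (f y) ->
    normc (g y - g x) <= K * ((Re (f y) - Re (f x)) ^+ 2 + (Im (f y) - Im (f x)) ^+ 2).
  move=> /hK; rewrite sqr_normcE !ReD !ReN !ImD !ImN.
  rewrite (_ : cauchy_transform mu (f y) - _ - _ = g y - g x) //.
  by rewrite /g; ring.
have hd := half_disc_near f0 fa.
have g0 : cder g x 0.
  split; apply: (der_squeeze (K := K) h1 h2); apply: filterS hd => y /gK; apply: le_trans.
    by rewrite -ReN -ReD ler_normc_Re.
  by rewrite -ImN -ImD ler_normc_Im.
apply: cder_ext (cderD g0 (cderMl (dcauchy mu (f x)) fa)) _ _ => [y|].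
  by rewrite /g subrK.
by rewrite add0r.
Qed.

End ComplexCurves.

(** * Continuation of the differential equation to the upper half-plane *)

Section AnalyticContinuation.
Variables (R : realType) (mu : probability (measurableTypeR R) R) (c : R).
Local Notation C := R[i].
Local Notation G := (cauchy_transform mu).
Local Notation G' := (dcauchy mu).

Definition seg (a b : C) (s : R) : C := a + s%:C * (b - a).

Lemma cder_seg a b s : cder (seg a b) s (b - a).
Proof.
apply: cder_ext (cderD (cder_cst a s) (cderM (cder_real (der_id s)) (cder_cst (b - a) s))) _ _ => //.
by rewrite add0r mulr0 addr0 mul1r.
Qed.

Lemma Im_seg_gt0 a b s : 0 < Im a -> 0 < Im b -> 0 <= s <= 1 -> 0 < Im (seg a b s).
Proof.
move=> a0 b0 /andP[s0 s1]; rewrite /seg ImD ImM /= ImD ImN mul0r addr0.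
rewrite (_ : _ + _ = (1 - s) * Im a + s * Im b); last by ring.
have [->|sN] := eqVneq s 0; first by rewrite subr0 mul1r mul0r addr0.
by rewrite ltr_wpDl ?mulr_ge0 ?subr_ge0 ?(ltW a0) // mulr_gt0 // lt0r sN.
Qed.

Lemma normc_seg a b s s' : normc (seg a b s - seg a b s') = `|s - s'| * normc (b - a).
Proof.
rewrite /seg opprD addrACA subrr add0r -mulrBl ComplexField.Normc.normcM.
by rewrite -rmorphB normc_real.
Qed.

(* Vanishes exactly when [F' (1 - c / F) = 1] for [F = 1 / G], i.e. when
   [F - c log F] has derivative [1]. *)
Definition ode_defect (w : C) : C := G' w * (1 - c%:C * G w) + G w ^+ 2.
Local Notation E := ode_defect.

Lemma ode_defect_expands (w0 : C) : 0 < Im w0 ->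
  exists a, expands (half_disc w0) (fun w => w - w0) E (fun _ => a).
Proof.
move=> w00; have [a1 h1] := dcauchy_expands mu w00; have h0 := cauchy_expands mu w00.
have hc := expandsM (expands_cst (half_disc w0) (fun w => w - w0) (- c%:C)) h0.
have h2 := expandsD (expandsM h1 (expandsD (expands_cst (half_disc w0) (fun w => w - w0) 1) hc)) (expandsM h0 h0).
eexists; rewrite (_ : E = fun w => G' w * (1 + - c%:C * G w) + G w * G w); first exact: h2.
by apply/funext => w; rewrite /ode_defect; ring.
Qed.

Lemma ode_defect_local (w0 : C) : 0 < Im w0 ->
  (forall d : R, 0 < d -> exists w, [/\ half_disc w0 w, w != w0, normc (w - w0) < d & E w = 0]) ->
  exists2 r : R, 0 < r & forall w, normc (w - w0) < r -> E w = 0.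
Proof.
move=> w00 acc; have [a ha] := ode_defect_expands w00.
have [r r0 hr] := expands_vanish ha acc.
exists (Num.min r (Im w0 / 2)); first by rewrite lt_min r0 divr_gt0.
by move=> w; rewrite lt_min => /andP[h1 h2]; apply: hr => //; rewrite /half_disc /= ltW.
Qed.

(** A supremum argument on [[0, 1]]: let [u] be the supremum of the parameters up to which [E]
    vanishes on the segment. Zeros accumulate at [seg a b u] from the left, so [E] vanishes on a
    disc around it by [ode_defect_local], and [u < 1] would contradict the choice of [u]. *)
Lemma ode_defect_continuation (a b : C) : 0 < Im a -> 0 < Im b ->
  (exists2 r : R, 0 < r & forall w, normc (w - a) < r -> E w = 0) -> E b = 0.
Proof.
move=> a0 b0 [r r0 hr].
have [->|ab] := eqVneq b a; first by apply: hr; rewrite subrr ComplexField.Normc.normc0.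
have L0 : 0 < normc (b - a) by rewrite normc_gt0 subr_eq0.
set L := normc (b - a) in L0.
pose S := [set s : R | 0 <= s <= 1 /\ forall t, 0 <= t <= s -> E (seg a b t) = 0].
have seg0 : seg a b 0 = a by rewrite /seg mul0r addr0.
have S_start s : 0 <= s <= 1 -> s * L < r -> S s.
  move=> s01 sL; split=> // t /andP[t0 ts]; apply: hr.
  rewrite -{2}seg0 normc_seg subr0 ger0_norm //.
  by apply: le_lt_trans sL; rewrite ler_wpM2r ?(ltW L0).
have hS : has_sup S.
  split; last by exists 1 => s [/andP[]].
  by exists 0; apply: S_start; rewrite ?lexx ?ler01 ?mul0r.
set u := sup S.
have u1 : u <= 1 by apply: ge_sup; [exact: hS.1|move=> s [/andP[]]].
have u0 : 0 < u.
  pose s0 := Num.min 1 (r / L / 2).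
  have s00 : 0 < s0 by rewrite lt_min ltr01 !divr_gt0.
  apply: (lt_le_trans s00); apply: (sup_upper_bound hS); apply: S_start.
    by rewrite (ltW s00) ge_min lexx.
  rewrite -ltr_pdivlMr //; apply: (@le_lt_trans _ _ (r / L / 2)); first by rewrite ge_min lexx orbT.
  by rewrite ltr_pdivrMr // ltr_pMr ?divr_gt0 // ltr1n.
have Elt s : 0 <= s -> s < u -> E (seg a b s) = 0.
  move=> s0 su; have [t [_ ht] st] := sup_adherent (eps := u - s) (ltac:(by rewrite subr_gt0)) hS.
  by apply: ht; rewrite s0 /= ltW //; move: st; rewrite -/u subKr.
have uin : 0 <= u <= 1 by rewrite (ltW u0).
have gu0 := Im_seg_gt0 a0 b0 uin.
have [|e e0 he] := @ode_defect_local (seg a b u) gu0.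
  move=> d d0.
  (* [m] keeps the nearby zero within distance [d] and inside the half disc; [dl] is a step back
     along the segment, shorter than [m] and keeping the parameter positive. *)
  pose m := Num.min d (Im (seg a b u) / 2).
  have m0 : 0 < m by rewrite lt_min d0 divr_gt0.
  pose dl := Num.min (u / 2) (m / L / 2).
  have dl0 : 0 < dl by rewrite lt_min !divr_gt0.
  have dlu : dl < u.
    apply: (@le_lt_trans _ _ (u / 2)); first by rewrite ge_min lexx.
    by rewrite ltr_pdivrMr // ltr_pMr // ltr1n.
  have nE : normc (seg a b (u - dl) - seg a b u) < m.
    rewrite normc_seg addrAC subrr add0r normrN gtr0_norm // -ltr_pdivlMr //.
    apply: (@le_lt_trans _ _ (m / L / 2)); first by rewrite ge_min lexx orbT.
    by rewrite ltr_pdivrMr // ltr_pMr ?divr_gt0 // ltr1n.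
  move: (nE); rewrite lt_min => /andP[nd ni].
  exists (seg a b (u - dl)); split => //.
  - by rewrite /half_disc /= ltW.
  - rewrite -subr_eq0 -normc_gt0 normc_seg addrAC subrr add0r normrN mulr_gt0 //.
    by rewrite normr_gt0 gt_eqF.
  - by apply: Elt; rewrite ?subr_ge0 ?ltW // ltrBlDr ltrDl.
have Enear s : `|s - u| < e / L -> E (seg a b s) = 0.
  by move=> hs; apply: he; rewrite normc_seg -ltr_pdivlMr.
suff u1E : u = 1.
  have -> : b = seg a b 1 by rewrite /seg mul1r addrC subrK.
  by apply: Enear; rewrite u1E subrr normr0 divr_gt0.
apply/eqP; rewrite eq_le u1 /=.
rewrite leNgt; apply/negP => ult1.
pose v := Num.min 1 (u + e / L / 2).
have uv : u < v by rewrite lt_min ult1 ltrDl !divr_gt0.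
suff Sv : S v by have := sup_upper_bound hS Sv; rewrite -/u leNgt uv.
split; first by rewrite (ltW (lt_trans u0 uv)) /= ge_min lexx.
move=> t /andP[t0 tv]; have [tu|ut] := ltP t u; first exact: Elt.
apply: Enear; rewrite ger0_norm ?subr_ge0 // ltrBlDl.
apply: (le_lt_trans tv); apply: (@le_lt_trans _ _ (u + e / L / 2)); first by rewrite ge_min lexx orbT.
by rewrite ltrD2l ltr_pdivrMr // ltr_pMr ?divr_gt0 // ltr1n.
Qed.

(** This is [H (i r)]: since [log (i r) = ln r + i pi / 2] and [2 rho + c pi / 2 = 1], the imaginary
    part is [r - 1], free of [rho]. *)
Definition Hcurve (r : R) : C := (- (c * ln r)) +i* (r - 1).

Lemma cder_Hcurve r : 0 < r -> cder Hcurve r ((- (c / r)) +i* 1).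
Proof.
move=> r0; split => /=.
  apply: der_ext (derMl (- c) (is_derive1_ln r0)) _ _ => [y|]; by rewrite mulNr.
by apply: der_ext (derB (der_id r) (der_cst 1 r)) _ _; rewrite ?subr0.
Qed.

Hypothesis curve_eq :
  exists2 M : R, 1 <= M & forall r, M < r -> G (Hcurve r) = (0 +i* r)^-1.

(** Both sides of [G (Hcurve r) = 1 / (i r)] are differentiated in [r]. The curve has velocity
    [i (1 - c / (i r)) = i (1 - c G)], the right-hand side has derivative [- i / (i r)^2 = - i G^2],
    and the common factor [i] cancels. *)
Lemma ode_defect_curve : exists2 M : R, 1 <= M & forall r, M < r -> E (Hcurve r) = 0.
Proof.
have [M M1 hM] := curve_eq; exists M => // r Mr.
have r1 : 1 < r by exact: le_lt_trans Mr.
have r0 : 0 < r by exact: lt_trans r1.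
have ri0 : (0 +i* r : C) != 0 by rewrite Im_gt0_neq0.
have I0 : 0 < Im (Hcurve r) by rewrite /= subr_gt0.
have d1 := cder_cauchy mu I0 (cder_Hcurve r0).
have d2 : cder (fun y : R => (0 +i* y : C)) r (0 +i* 1).
  by split => /=; [exact: der_cst|exact: der_id].
have d3 : cder (fun y => G (Hcurve y)) r (- (0 +i* 1) / (0 +i* r) ^+ 2).
  apply: cder_near (cderV ri0 d2).
  near=> y; rewrite hM //; near: y; exact: lt_nbhsr.
have dE := cder_unique d1 d3.
rewrite /ode_defect hM //.
have cE : ((- (c / r)) +i* 1 : C) = (0 +i* 1) * (1 - c%:C * (0 +i* r)^-1).
  apply: complexP; rewrite ?ReM ?ImM !ReD !ImD !ReN !ImN !ReM !ImM Re_invc Im_invc /=.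
    by field; rewrite gt_eqF.
  by field; rewrite gt_eqF.
have i0 : (0 +i* 1 : C) != 0 by rewrite Im_gt0_neq0 //=.
move: dE; rewrite cE => dE.
apply: (mulfI i0); rewrite mulr0 mulrDr.
rewrite mulrCA dE exprVn mulNr; exact: addNr.
Unshelve. all: by end_near.
Qed.

(** The curve has no isolated points, so zeros of the defect accumulate at [Hcurve (M + 1)]; it
    vanishes on a disc there, and from there along segments. *)
Lemma ode_defect_eq0 (w : C) : 0 < Im w -> E w = 0.
Proof.
have [M M1 hM] := ode_defect_curve => w0.
pose r := M + 1; have Mr : M < r by rewrite ltrDl.
have r1 : 1 < r by exact: le_lt_trans Mr.
have r0 : 0 < r by exact: lt_trans r1.
have I0 : 0 < Im (Hcurve r) by rewrite /= subr_gt0.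
apply: (ode_defect_continuation I0 w0); apply: ode_defect_local => // d d0.
have dH := cder_Hcurve r0.
have hd := half_disc_near I0 dH.
have c1 := der_continuous dH.1; have c2 := der_continuous dH.2.
have d2 : 0 < d / 2 by rewrite divr_gt0.
have : \forall y \near r, [/\ half_disc (Hcurve r) (Hcurve y), M < y & normc (Hcurve y - Hcurve r) < d].
  near=> y; split.
  - by near: y.
  - by near: y; exact: lt_nbhsr.
  - apply: le_lt_trans (normc_ReIm _) _; rewrite ReD ReN ImD ImN [ltRHS]splitr.
    apply: ltrD.
      by near: y; apply: cvgr_distC_lt => //; exact: c1.
    by near: y; apply: cvgr_distC_lt => //; exact: c2.
case=> e e0 he.
have [|h1 h2 h3] := he (r + e / 2).
  rewrite /ball_ /= opprD addrA subrr sub0r normrN gtr0_norm ?divr_gt0 //.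
  by rewrite ltr_pdivrMr // ltr_pMr // ltr1n.
exists (Hcurve (r + e / 2)); split => //; last exact: hM.
apply/eqP => /(congr1 (fun z : C => Im z)) /= h.
have : 0 < e / 2 by rewrite divr_gt0.
lra.
Unshelve. all: by end_near.
Qed.

End AnalyticContinuation.

(** * The relation [H (1 / G w) = w] and its polar form *)

Section InverseOfF.
Variables (R : realType) (mu : probability (measurableTypeR R) R) (c k : R).
Local Notation C := R[i].
Local Notation G := (cauchy_transform mu).
Local Notation G' := (dcauchy mu).

(* The principal logarithm on the upper half-plane, where its argument is the
   arc cotangent of [Re z / Im z]. *)
Definition clog (z : C) : C :=
  (2^-1 * ln (Re z ^+ 2 + Im z ^+ 2)) +i* (pi / 2 - atan (Re z / Im z)).

Lemma cder_clog (f : R -> C) x (d : C) : 0 < Im (f x) -> cder f x d ->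
  cder (fun y => clog (f y)) x (d / f x).
Proof.
move=> f0 [f1 f2].
have n0 : 0 < Re (f x) ^+ 2 + Im (f x) ^+ 2 by rewrite ltr_wpDl ?sqr_ge0 ?exprn_gt0.
have dn := derD (derX 1 f1) (derX 1 f2).
have i0 : Im (f x) != 0 by rewrite gt_eqF.
split => /=.
  have dl := derMl 2^-1 (der_comp (f := @ln R) (x := x) (g := fun y => Re (f y) ^+ 2 + Im (f y) ^+ 2) (is_derive1_ln n0) dn).
  apply: der_ext dl _ _ => //.
  rewrite ReM Re_invc Im_invc !expr1; field; rewrite ?gt_eqF //.
have da := der_comp (f := @atan R) (x := x) (g := fun y => Re (f y) * (Im (f y))^-1) (is_derive1_atan _) (derM f1 (derV i0 f2)).
apply: der_ext (derB (der_cst (pi / 2) x) da) _ _ => //.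
rewrite ImM Re_invc Im_invc; field.
by rewrite i0 !gt_eqF // addrC.
Qed.

Definition Hmap (z : C) : C := z - c%:C * clog z - (0 +i* k).

Hypothesis ck : k + c * (pi / 2) = 1.
Hypothesis curve_eq :
  exists2 M : R, 1 <= M & forall r, M < r -> G (Hcurve c r) = (0 +i* r)^-1.

Lemma Im_invG_gt0 (w : C) : 0 < Im w -> 0 < Im (G w)^-1.
Proof.
move=> /(Im_cauchy_lt0 mu) h; rewrite Im_invc divr_gt0 ?oppr_gt0 //.
by rewrite ltr_wpDl ?sqr_ge0 // exprn_even_gt0 //= lt_eqF.
Qed.

Lemma cauchy_neq0 (w : C) : 0 < Im w -> G w != 0.
Proof.
by move=> /(Im_cauchy_lt0 mu) h; apply: contraTneq h => ->; rewrite ltxx.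
Qed.

(** For [c != 0] the imaginary part is nonzero because [Im G < 0]; for [c = 0] the factor is 1. *)
Lemma ode_factor_neq0 (w : C) : 0 < Im w -> 1 - c%:C * G w != 0.
Proof.
move=> w0; have g0 := Im_cauchy_lt0 mu w0.
apply/eqP => h; have := congr1 (fun z : C => Im z) h.
rewrite ImD ImN ImM /= mul0r addr0 sub0r => /eqP; rewrite oppr_eq0 mulf_eq0.
rewrite (lt_eqF g0) orbF => /eqP c0.
by move/eqP: h; rewrite c0 mul0r subr0 oner_eq0.
Qed.

(** Along the segment, [H (1 / G)] has derivative [(1 - c G) (- G' / G^2) (b - a)], and the
    differential equation says that the first two factors multiply to 1. *)
Lemma cder_Hmap_invG (a b : C) (s : R) : 0 < Im (seg a b s) ->
  cder (fun y => Hmap (G (seg a b y))^-1) s (b - a).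
Proof.
move=> h0; have g0 := cauchy_neq0 h0.
have dz := cderV (f := fun y => G (seg a b y)) g0 (cder_cauchy mu h0 (cder_seg a b s)).
have dl := cder_clog (f := fun y => (G (seg a b y))^-1) (Im_invG_gt0 h0) dz.
apply: cder_ext (cderB (cderB dz (cderMl c%:C dl)) (cder_cst (0 +i* k) s)) _ _ => //.
have := ode_defect_eq0 curve_eq h0; rewrite /ode_defect => /eqP.
rewrite addr_eq0 => /eqP E0.
have -> : G' (seg a b s) = - G (seg a b s) ^+ 2 / (1 - c%:C * G (seg a b s)).
  by rewrite -E0 mulfK // ode_factor_neq0.
have := ode_factor_neq0 h0.
set g := G _ in g0 *; move=> f0.
by field; rewrite f0 g0.
Qed.

Lemma Hmap_invG (w : C) : 0 < Im w -> Hmap (G w)^-1 = w.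
Proof.
move=> w0; have [M M1 hM] := curve_eq.
pose r := M + 1; have Mr : M < r by rewrite ltrDl.
have r1 : 1 < r by exact: le_lt_trans Mr.
have r0 : 0 < r by exact: lt_trans r1.
pose a := Hcurve c r.
have a0 : 0 < Im a by rewrite /= subr_gt0.
(* At [a = H (i r)] one has [1 / G a = i r], and [ck] matches the imaginary parts. *)
have Ha : Hmap (G a)^-1 = a.
  rewrite /a hM // invrK /Hmap /clog /=.
  apply: complexP; rewrite !(ReD, ImD, ReN, ImN, ReM, ImM) /=.
    rewrite expr0n /= !add0r lnXn // mul0r subr0 oppr0 addr0 mulr2n; by field.
  rewrite mul0r atan0 subr0 mul0r addr0.
  by rewrite -addrA -opprD [_ + k]addrC ck.
pose f y := Hmap (G (seg a w y))^-1 - seg a w y.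
have df y : 0 <= y <= 1 -> cder f y 0.
  move=> y01; have := cder_Hmap_invG (Im_seg_gt0 a0 w0 y01).
  by move=> h; apply: cder_ext (cderB h (cder_seg a w y)) _ _ => //; rewrite subrr.
have seg0 : seg a w 0 = a by rewrite /seg mul0r addr0.
have seg1 : seg a w 1 = w by rewrite /seg mul1r addrC subrK.
have const (h : R -> R) : (forall y : R, 0 <= y <= 1 -> is_derive y 1 h 0) -> h 1 = h 0.
  move=> dh; have [y hy|y _] := @MVT_segment R h (fun=> 0) 0 1 ler01 _ (der_within_continuous dh).
    apply: dh; move: hy; rewrite in_itv /= => /andP[? ?]; by rewrite !ltW.
  by rewrite mul0r => /eqP; rewrite subr_eq0 => /eqP.
have f01 : f 1 = f 0.
  by apply: complexP; [apply: (const (fun y => Re (f y)))|apply: (const (fun y => Im (f y)))] => y /df[].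
move: f01; rewrite /f seg0 seg1 Ha subrr => /eqP; by rewrite subr_eq0 => /eqP.
Qed.

(** Write [1 / G = v (cot theta + i)]. The imaginary part of [H (1 / G) = x + i e] reads
    [v = k + c theta + e]; the real part gives the formula for [x], because the modulus of [1 / G]
    is [v / sin theta]. *)
Lemma cauchy_polar (x e : R) : 0 < e ->
  exists theta : R, [/\ 0 < theta < pi, 0 < k + c * theta + e,
    x = (k + c * theta + e) * cot theta + c * ln (sin theta / (k + c * theta + e)) &
    - Im (G (x +i* e)) = sin theta ^+ 2 / (k + c * theta + e)].
Proof.
move=> e0; have := Hmap_invG (w := x +i* e) e0; have := Im_invG_gt0 (w := x +i* e) e0.
have -> : Im (G (x +i* e)) = Im ((G (x +i* e))^-1)^-1 by rewrite invrK.
case: ((G (x +i* e))^-1) => u v /= v0 [hx he].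
pose a := atan (u / v); pose t := pi / 2 - a.
have [a1 a2] : - (pi / 2) < a /\ a < pi / 2 by rewrite atan_gtNpi2 atan_ltpi2.
have ta : tan a = u / v by rewrite /a atanK.
have st : sin t = cos a by rewrite /t sinB sin_pihalf cos_pihalf mul1r mul0r subr0.
have ct : cos t = sin a by rewrite /t cosB sin_pihalf cos_pihalf mul1r mul0r add0r.
have ca0 : 0 < cos a by apply: cos_gt0_pihalf; rewrite a1 a2.
have ve : k + c * t + e = v by move: he; rewrite mul0r addr0 -/a -/t; lra.
have uv : u = v * cot t.
  by rewrite /cot st ct -/(tan a) ta mulrC divfK // gt_eqF.
have nE : u ^+ 2 + v ^+ 2 = (v / sin t) ^+ 2.
  have := cos2Dsin2 t; rewrite uv /cot => h.
  have -> : (v / sin t) ^+ 2 = (v / sin t) ^+ 2 * (cos t ^+ 2 + sin t ^+ 2) by rewrite h mulr1.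
  by field; rewrite st gt_eqF.
exists t; split; rewrite ?ve //.
- by apply/andP; split; rewrite /t; lra.
- rewrite -hx nE mul0r subr0 oppr0 addr0 lnXn ?divr_gt0 ?st // -st.
  rewrite -[sin t / v]invf_div lnV ?posrE ?divr_gt0 ?st // -st uv mulr2n; by field.
- by rewrite nE opprK; field; rewrite st !gt_eqF.
Qed.

End InverseOfF.

(** * The Voiculescu transform on the imaginary axis *)

Section VoiculescuCurve.
Variables (R : realType).
Local Notation C := R[i].

Lemma pi_neq0 : pi != 0 :> R.
Proof. by rewrite gt_eqF // pi_gt0. Qed.

Definition slope (rho : R) : R := 2 / pi * (1 - 2 * rho).

Lemma slopeP (rho : R) : 2 * rho + slope rho * (pi / 2) = 1.
Proof. by rewrite /slope; move: pi_neq0; move: pi => p p_neq0; field. Qed.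

(** Above height [M] the imaginary axis lies in the truncated cone, and there [Finv z = z + phi z]
    is [Hcurve]. Taking the threshold at least 1 places the curve in the upper half-plane. *)
Lemma nu1_curve (rho : R) (nu : probability (measurableTypeR R) R) : is_nu1 rho nu ->
  exists2 M : R, 1 <= M & forall r, M < r ->
    cauchy_transform nu (Hcurve (slope rho) r) = (0 +i* r)^-1.
Proof.
move=> /(_ 1 ltr01) [M [M0 [Finv [[_ hI hF _] hphi]]]].
have p0 := pi_gt0 R.
exists (Num.max 1 M); first by rewrite le_max lexx.
move=> r; rewrite gt_max => /andP[r1 rM].
have r0 : 0 < r by exact: lt_trans r1.
have hz : truncated_cone 1 M (0 +i* r).
  by rewrite /truncated_cone /= normr0 mul1r.
have zE : Finv (0 +i* r) = Hcurve (slope rho) r.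
  apply/eqP; rewrite -[Finv _](subrK (0 +i* r)) -hphi //; apply/eqP.
  rewrite /phi1 /principal_log /principal_arg normc_def /= expr0n /= add0r sqrtr_sqr gtr0_norm //.
  (* On the imaginary axis the principal argument is [acos 0 = pi / 2]. *)
  rewrite (ltW r0) mul0r acos0.
  apply: complexP; rewrite /= ?(mul0r, mulr0, oppr0, add0r, addr0, subr0) /slope.
    by move: pi_neq0; move: pi => p p_neq0; field.
  by move: pi_neq0; move: pi => p p_neq0; field.
by rewrite -zE -[LHS]invrK; congr (_^-1); exact: hF.
Qed.

Lemma nu1_polar (rho : R) (nu : probability (measurableTypeR R) R) (x e : R) :
  is_nu1 rho nu -> 0 < e ->
  let k := 2 * rho in let c := slope rho in
  exists theta : R, [/\ 0 < theta < pi, 0 < k + c * theta + e,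
    x = (k + c * theta + e) * cot theta + c * ln (sin theta / (k + c * theta + e)) &
    - Im (cauchy_transform nu (x +i* e)) = sin theta ^+ 2 / (k + c * theta + e)].
Proof. by move=> /nu1_curve h e0; apply: cauchy_polar => //; exact: slopeP. Qed.

End VoiculescuCurve.

(** * Monotonicity and range of the boundary function X *)

Section BoundaryCurve.
Variable R : realType.
Implicit Types (k c t x : R).

(* [Hmap c k] is real exactly at the points [(k + c t) (cot t + i)], of argument
   [t], where its value is [Xfun k c t]; replacing [k] by [k + e] gives the curve
   on which its imaginary part is [e]. *)
Definition Xfun k c t : R := (k + c * t) * cot t + c * ln (sin t / (k + c * t)).

(** This is [- |z - c|^2 / w] for [w = k + c t] and [z = w (cot t + i)]; [dist_sqr_polar] relates
    the two sums of squares. *)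
Definition dXfun k c t : R :=
  - (((k + c * t) / sin t - c * cos t) ^+ 2 + (c * sin t) ^+ 2) / (k + c * t).

Lemma der_cot t : 0 < t < pi -> is_derive t 1 (@cot R) (- (sin t)^-1 ^+ 2).
Proof.
move=> /sin_gt0_pi s0; have sN : sin t != 0 by rewrite gt_eqF.
apply: der_ext (derM (is_derive_cos t) (derV sN (is_derive_sin t))) _ _ => //.
have := cos2Dsin2 t => h.
have -> : - (sin t)^-1 ^+ 2 = - (cos t ^+ 2 + sin t ^+ 2) / sin t ^+ 2.
  by rewrite h mulNr mul1r exprVn.
by field.
Qed.

Lemma der_Xfun k c t : 0 < t < pi -> 0 < k + c * t ->
  is_derive t 1 (Xfun k c) (dXfun k c t).
Proof.
move=> tpi w0; have s0 := sin_gt0_pi tpi.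
have sN : sin t != 0 by rewrite gt_eqF.
have wN : k + c * t != 0 by rewrite gt_eqF.
have dw : is_derive t 1 (fun y : R => k + c * y) c.
  by apply: der_ext (derD (der_cst k t) (derMl c (der_id t))) _ _ => //; rewrite add0r mulr1.
have sw : 0 < sin t * (k + c * t)^-1 by rewrite divr_gt0.
have dl := der_comp (f := @ln R) (x := t) (g := fun y => sin y * (k + c * y)^-1)
  (is_derive1_ln sw) (derM (is_derive_sin t) (derV (f := fun y => k + c * y) wN dw)).
apply: der_ext (derD (derM dw (der_cot tpi)) (derMl c dl)) _ _ => //.
rewrite /dXfun /cot.
have h := cos2Dsin2 t.
have -> : ((k + c * t) / sin t - c * cos t) ^+ 2 + (c * sin t) ^+ 2 =
    ((k + c * t) / sin t) ^+ 2 - 2 * c * cos t * ((k + c * t) / sin t) +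
    c ^+ 2 * (cos t ^+ 2 + sin t ^+ 2) by ring.
rewrite h; field.
by rewrite sN wN.
Qed.

Lemma dXfun_lt0 k c t : 0 < t < pi -> 0 < k + c * t -> dXfun k c t < 0.
Proof.
move=> tpi w0; have s0 := sin_gt0_pi tpi.
rewrite /dXfun mulNr oppr_lt0 divr_gt0 //.
have [c0|cN] := eqVneq c 0.
  by rewrite {2 3}c0 !mul0r subr0 expr0n addr0 exprn_gt0 // divr_gt0.
by rewrite ltr_wpDl ?sqr_ge0 // exprn_even_gt0 //= mulf_neq0 // gt_eqF.
Qed.

Lemma Xfun_decr k c : (forall t, 0 < t < pi -> 0 < k + c * t) ->
  forall s t, 0 < s -> s < t -> t < pi -> Xfun k c t < Xfun k c s.
Proof.
move=> wpos s t s0 st tpi.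
have hd y : s <= y <= t -> is_derive y 1 (Xfun k c) (dXfun k c y).
  move=> /andP[sy yt]; have y0 : 0 < y < pi by rewrite (lt_le_trans s0 sy) (le_lt_trans yt).
  by apply: der_Xfun => //; exact: wpos.
have [y hy|y] := @MVT R (Xfun k c) (dXfun k c) s t st _ (der_within_continuous hd).
  by apply: hd; move: hy; rewrite in_itv /= => /andP[? ?]; rewrite !ltW.
rewrite in_itv /= => /andP[sy yt] /eqP; rewrite subr_eq => /eqP ->.
have y0 : 0 < y < pi by rewrite (lt_trans s0 sy) (lt_trans yt).
by rewrite gtrDr nmulr_rlt0 ?subr_gt0 // dXfun_lt0 // wpos.
Qed.

Lemma Xfun_inj k c : (forall t, 0 < t < pi -> 0 < k + c * t) ->
  forall s t, 0 < s < pi -> 0 < t < pi -> Xfun k c s = Xfun k c t -> s = t.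
Proof.
move=> wpos s t /andP[s0 s1] /andP[t0 t1] E.
by have [st|ts|//] := ltgtP s t;
  [have := Xfun_decr wpos s0 st t1|have := Xfun_decr wpos t0 ts s1]; rewrite E ltxx.
Qed.

Lemma Xfun_IVT k c x s t : (forall t, 0 < t < pi -> 0 < k + c * t) ->
  0 < s < pi -> 0 < t < pi -> Xfun k c t < x -> x < Xfun k c s ->
  exists u, 0 < u < pi /\ x = Xfun k c u.
Proof.
move=> wpos /andP[s0 s1] /andP[t0 t1] tx xs.
have st : s < t.
  rewrite ltNge le_eqVlt; apply/negP => /orP[/eqP E|h].
    by have := lt_trans tx xs; rewrite E ltxx.
  by have := lt_trans (lt_trans tx xs) (Xfun_decr wpos t0 h s1); rewrite ltxx.
have hd y : s <= y <= t -> is_derive y 1 (Xfun k c) (dXfun k c y).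
  move=> /andP[sy yt]; have y0 : 0 < y < pi by rewrite (lt_le_trans s0 sy) (le_lt_trans yt).
  by apply: der_Xfun => //; exact: wpos.
have [|u] := @IVT R (Xfun k c) s t x (ltW st) (der_within_continuous hd).
  by rewrite ge_min (ltW tx) orbT le_max (ltW xs).
rewrite in_itv /= => /andP[su ut] ux.
by exists u; rewrite ux (lt_le_trans s0 su) (le_lt_trans ut).
Qed.

(** The symmetry [t -> pi - t] exchanges the end values of the width and changes the sign of [c]. It
    transfers the behaviour near pi to 0, and the case [rho = 0] to [rho = 1]. *)
Lemma Xfun_reflect k c t : Xfun (k + c * pi) (- c) (pi - t) = - Xfun k c t.
Proof.
have E : k + c * pi + - c * (pi - t) = k + c * t by ring.
have sE : sin (pi - t) = sin t by rewrite sinB sinpi cospi mul0r mulN1r sub0r opprK.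
have cE : cos (pi - t) = - cos t by rewrite cosB sinpi cospi mul0r mulN1r addr0.
by rewrite /Xfun /cot E sE cE; ring.
Qed.

Lemma ln_le_sqr t : 1 <= t -> 0 <= ln (t ^+ 2) <= 2 * t.
Proof.
move=> t1; have t0 : 0 < t by exact: lt_le_trans t1.
rewrite ln_ge0 ?exprn_ege1 //= lnXn // mulr2n mulrDl mul1r.
have : ln t <= t - 1 by have := @le_ln1Dx R (t - 1); rewrite [1 + _]addrC subrK; apply; lra.
by move=> h; apply: lerD; lra.
Qed.

(** With [q^2 = (k + c t) / sin t] one has [X = q^2 cos t - c ln (q^2)]. Near pi, [q] is large and
    [cos t < - 1/2], so the quadratic term wins over the logarithm, which is at most [2 q]. *)
Lemma Xfun_unbounded_below k c x : 0 < k + c * pi ->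
  exists t, [/\ 0 < t < pi, 0 < k + c * t & Xfun k c t < x].
Proof.
move=> wpi.
(* For [q > T] one gets [2 |c| - q / 2 < - |x| / 2 - 1]; as [q >= 2], this puts [q (2 |c| - q / 2)]
   below [- |x| - 2]. *)
pose T : R := 4 * `|c| + `|x| + 3.
have T1 : 1 <= T.
  by rewrite /T; have := normr_ge0 c; have := normr_ge0 x; lra.
(* Written without division by [sin t], the condition [q > T] is continuous at pi, where it reads
   [0 < k + c pi]. *)
have c1 : {for pi, continuous (fun t : R => k + c * t - T ^+ 2 * sin t)}.
  have dw := derB (derD (der_cst k pi) (derMl c (der_id pi))) (derMl (T ^+ 2) (is_derive_sin (pi : R))).
  exact: der_continuous dw.
have p1 : \forall t \near (pi : R), 0 < k + c * t - T ^+ 2 * sin t.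
  by apply: (cvgr_gt _ c1); rewrite sinpi mulr0 subr0.
have p2 : \forall t \near (pi : R), cos t < - (1 / 2).
  by apply: (cvgr_lt _ (@continuous_cos R pi)); rewrite cospi; lra.
have [t [t0 tpi h1 h2]] : exists t : R, [/\ 0 < t, t < pi, 0 < k + c * t - T ^+ 2 * sin t & cos t < - (1 / 2)].
  have : \forall t \near pi^'-, [/\ 0 < t, t < pi, 0 < k + c * t - T ^+ 2 * sin t & cos t < - (1 / 2)].
    near=> t; split.
    - by near: t; exact: nbhs_left_gt (pi_gt0 R).
    - by [].
    - by near: t; rewrite near_withinE; apply: filterS p1 => y.
    - by near: t; rewrite near_withinE; apply: filterS p2 => y.
  by move=> /filter_ex.
have tin : 0 < t < pi by rewrite t0.
have s0 := sin_gt0_pi tin.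
have w0 : 0 < k + c * t.
  by move: h1; rewrite subr_gt0; apply: le_lt_trans; rewrite mulr_ge0 ?sqr_ge0 // ltW.
exists t; split => //.
have y0 : 0 < (k + c * t) / sin t by rewrite divr_gt0.
pose q := Num.sqrt ((k + c * t) / sin t).
have qE : q ^+ 2 = (k + c * t) / sin t by rewrite sqr_sqrtr // ltW.
have qT : T < q.
  have : T ^+ 2 < q ^+ 2 by rewrite qE ltr_pdivlMr // -subr_gt0.
  by rewrite ltr_sqr ?nnegrE ?sqrtr_ge0 // (le_trans ler01).
have -> : Xfun k c t = q ^+ 2 * cos t - c * ln (q ^+ 2).
  rewrite /Xfun /cot qE -[sin t / _]invf_div lnV ?posrE //.
  by field; rewrite gt_eqF.
have /andP[l0 l1] := ln_le_sqr (le_trans T1 (ltW qT)).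
have hc : - (c * ln (q ^+ 2)) <= `|c| * (2 * q).
  apply: (@le_trans _ _ (`|c| * ln (q ^+ 2))).
    by rewrite -mulNr ler_wpM2r // -normrN ler_norm.
  by rewrite ler_wpM2l.
have hq : q ^+ 2 * cos t <= q ^+ 2 * - (1 / 2) by rewrite ler_wpM2l ?sqr_ge0 // ltW.
have q0 : 0 < q by rewrite (lt_trans _ qT) // (lt_le_trans _ T1).
apply: (@le_lt_trans _ _ (q * (2 * `|c| - q / 2))).
  by rewrite expr2 in hq; rewrite expr2; lra.
have hq2 : 2 * `|c| - q / 2 < - (`|x| / 2) - 1.
  by move: qT; rewrite /T; lra.
apply: (@lt_le_trans _ _ (q * (- (`|x| / 2) - 1))); first by rewrite ltr_pM2l.
have q2 : 2 <= q by move: qT; rewrite /T; have := normr_ge0 c; have := normr_ge0 x; lra.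
apply: (@le_trans _ _ (2 * (- (`|x| / 2) - 1))).
  by rewrite ler_wnM2r // ; have := normr_ge0 x; lra.
have : - `|x| <= x by rewrite lerNl -normrN ler_norm.
by lra.
Unshelve. all: by end_near.
Qed.

Lemma Xfun_unbounded_above k c x : 0 < k ->
  exists t, [/\ 0 < t < pi, 0 < k + c * t & x < Xfun k c t].
Proof.
move=> k0.
have [|t [/andP[t0 t1] w0 ht]] := @Xfun_unbounded_below (k + c * pi) (- c) (- x).
  by rewrite mulNr addrK.
exists (pi - t); rewrite ltrBrDl addr0 t1 ltrBlDr ltrDl t0; split=> //.
  by rewrite (_ : _ + _ = k + c * pi + - c * t) //; ring.
rewrite -ltrN2 -Xfun_reflect.
by rewrite (_ : pi - (pi - t) = t) //; ring.
Qed.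

End BoundaryCurve.

(** * Limits of the angles as the height tends to 0 *)

Section BoundaryLimit.
Variable R : realType.
Implicit Types (k c t x : R).

Lemma sin_le_id t : 0 <= t -> sin t <= t.
Proof.
move=> t0; have [|y _] := @MVT_segment R sin cos 0 t t0 (fun y _ => is_derive_sin y).
  by apply: (der_within_continuous (df := cos)) => y _; exact: is_derive_sin.
by rewrite sin0 !subr0 => ->; rewrite ler_piMl // cos_le1.
Qed.

Lemma cvg_sinc : (sin t / t : R) @[t --> (0 : R)^'+] --> (1 : R).
Proof.
have [d1 d2] := is_derive_sin (0 : R).
have h : (e^-1 *: (sin (e *: 1 + 0) - sin 0) : R) @[e --> (0 : R)^'] --> (1 : R).
  by rewrite -[X in _ --> X](@cos0 R) -d2; exact: d1.
have h' : (sin t / t : R) @[t --> (0 : R)^'] --> (1 : R).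
  rewrite (_ : (fun t => _) = fun e : R => e^-1 *: (sin (e *: 1 + 0) - sin 0)) //.
  by apply/funext => e; rewrite sin0 subr0 addr0 /GRing.scale /= mulr1 mulrC.
exact: cvg_dnbhs_at_right h'.
Qed.

Lemma Xfun0E c t : 0 < c -> 0 < t < pi ->
  Xfun 0 c t = c * (cos t / (sin t / t) + ln (sin t / t / c)).
Proof.
move=> c0 tpi; have s0 := sin_gt0_pi tpi; have /andP[t0 _] := tpi.
rewrite /Xfun /cot add0r [c * t]mulrC invfM mulrA mulrDr; congr (_ + _); last by rewrite mulrA.
by field; rewrite !gt_eqF.
Qed.

(** For [c = 2 / pi] this limit is the right end of the support of [nu_{1,0}]. It follows from
    [sin t / t -> 1], the only singular quotient in [Xfun0E]. *)
Lemma cvg_Xfun0 c : 0 < c -> Xfun 0 c t @[t --> (0 : R)^'+] --> c * (1 + ln c^-1).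
Proof.
move=> c0.
have -> : c * (1 + ln c^-1) = c * (cos 0 / 1 + ln (1 / c)) by rewrite cos0 invr1 !mul1r.
have near0 : \forall t \near (0 : R)^'+, c * (cos t / (sin t / t) + ln (sin t / t / c)) = Xfun 0 c t.
  near=> t; rewrite Xfun0E //; apply/andP; split => //.
  by near: t; exact: nbhs_right_lt (pi_gt0 R).
apply: cvg_trans (near_eq_cvg near0) _.
apply: cvgM; first exact: cvg_cst.
apply: cvgD.
  apply: cvgM; last by apply: cvgV; [exact: oner_neq0|exact: cvg_sinc].
  by apply: cvg_at_right_filter; exact: continuous_cos.
have h : (sin t / t / c : R) @[t --> (0 : R)^'+] --> (1 / c : R).
  by apply: cvgM; [exact: cvg_sinc|exact: cvg_cst].
by apply: (cvg_comp _ _ h); apply: continuous_ln; rewrite divr_gt0.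
Unshelve. all: by end_near.
Qed.

Lemma wpos0 c : 0 < c -> forall t, 0 < t < pi -> 0 < 0 + c * t.
Proof. by move=> c0 t /andP[t0 _]; rewrite add0r mulr_gt0. Qed.

Lemma Xfun0_lt c t : 0 < c -> 0 < t < pi -> Xfun 0 c t < c * (1 + ln c^-1).
Proof.
move=> c0 /andP[t0 tpi]; have t2 : 0 < t / 2 by rewrite divr_gt0.
have t2t : t / 2 < t by rewrite ltr_pdivrMr // ltr_pMr // ltr1n.
(* The intermediate angle [t / 2] gives strictness: [X t < X (t / 2)], and [X (t / 2)] is at most
   the limit. *)
apply: (lt_le_trans (Xfun_decr (wpos0 c0) t2 t2t tpi)).
rewrite leNgt; apply/negP => h.
have : \forall u \near (0 : R)^'+, Xfun 0 c u < Xfun 0 c (t / 2).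
  by apply: (cvgr_lt _ (cvg_Xfun0 c0)).
move=> hn.
have [u [u0 ut hu]] : exists u, [/\ 0 < u, u < t / 2 & Xfun 0 c u < Xfun 0 c (t / 2)].
  have : \forall u \near (0 : R)^'+, [/\ 0 < u, u < t / 2 & Xfun 0 c u < Xfun 0 c (t / 2)].
    near=> u; split; [by []|by near: u; exact: nbhs_right_lt|by near: u].
  by move=> /filter_ex.
have := Xfun_decr (wpos0 c0) u0 ut (lt_trans t2t tpi).
by move=> /(lt_trans hu); rewrite ltxx.
Unshelve. all: by end_near.
Qed.

Lemma Xfun0_near c x : 0 < c -> x < c * (1 + ln c^-1) ->
  exists t, 0 < t < pi /\ x < Xfun 0 c t.
Proof.
move=> c0 hx.
have hn : \forall u \near (0 : R)^'+, x < Xfun 0 c u by apply: (cvgr_gt _ (cvg_Xfun0 c0)).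
have : \forall u \near (0 : R)^'+, 0 < u < pi /\ x < Xfun 0 c u.
  near=> u; split; last by near: u.
  apply/andP; split => //; near: u; exact: nbhs_right_lt (pi_gt0 R).
by move=> /filter_ex[u]; exists u.
Unshelve. all: by end_near.
Qed.

Lemma cvg_Xfun_shift k c t (e : nat -> R) : 0 < t < pi -> 0 < k + c * t ->
  e @ \oo --> (0 : R) -> Xfun (k + e n) c t @[n --> \oo] --> Xfun k c t.
Proof.
move=> tpi w0 e0.
have w1 : (k + e n + c * t : R) @[n --> \oo] --> (k + c * t : R).
  apply: cvgD; last exact: cvg_cst.
  have := cvgD (cvg_cst k : cst k @ \oo --> k) e0; rewrite addr0; exact.
rewrite /Xfun; apply: cvgD.
  by apply: cvgM => //; exact: cvg_cst.
apply: cvgM; first exact: cvg_cst.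
have h : (sin t / (k + e n + c * t) : R) @[n --> \oo] --> (sin t / (k + c * t) : R).
  apply: cvgM; first exact: cvg_cst.
  by apply: cvgV => //; rewrite gt_eqF.
by apply: (cvg_comp _ _ h); apply: continuous_ln; rewrite divr_gt0 // sin_gt0_pi.
Qed.

(** Convergence is used at the single angle [d]: eventually [X_(e n) d < x = X_(e n) (th n)], and
    [X_(e n)] is decreasing. *)
Lemma theta_upper k c x d (th e : nat -> R) :
  (forall t, 0 < t < pi -> 0 < k + c * t) -> (forall n, 0 < e n) ->
  e @ \oo --> (0 : R) -> (forall n, 0 < th n < pi) ->
  (forall n, x = Xfun (k + e n) c (th n)) ->
  0 < d < pi -> Xfun k c d < x -> \forall n \near \oo, th n < d.
Proof.
move=> wpos e0 ecv thpi hth /[dup] dpi /andP[d0 d1] hd.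
have hn0 := cvgr_lt _ (cvg_Xfun_shift dpi (wpos _ dpi) ecv) _ hd.
apply: filterS (hn0 _) => n hn; rewrite ltNge le_eqVlt; apply/negP => /orP[/eqP E|h].
  by move: hn; rewrite E -hth ltxx.
have wn t : 0 < t < pi -> 0 < k + e n + c * t.
  by move=> /wpos; rewrite addrAC => h'; rewrite addr_gt0.
have /andP[_ t1] := thpi n.
by have := Xfun_decr wn d0 h t1; rewrite -hth => /(lt_trans hn); rewrite ltxx.
Qed.

Lemma theta_lower k c x d (th e : nat -> R) :
  (forall t, 0 < t < pi -> 0 < k + c * t) -> (forall n, 0 < e n) ->
  e @ \oo --> (0 : R) -> (forall n, 0 < th n < pi) ->
  (forall n, x = Xfun (k + e n) c (th n)) ->
  0 < d < pi -> x < Xfun k c d -> \forall n \near \oo, d < th n.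
Proof.
move=> wpos e0 ecv thpi hth /[dup] dpi /andP[d0 d1] hd.
have hn0 := cvgr_gt _ (cvg_Xfun_shift dpi (wpos _ dpi) ecv) _ hd.
apply: filterS (hn0 _) => n hn; rewrite ltNge le_eqVlt; apply/negP => /orP[/eqP E|h].
  by move: hn; rewrite -E -hth ltxx.
have wn t : 0 < t < pi -> 0 < k + e n + c * t.
  by move=> /wpos; rewrite addrAC => h'; rewrite addr_gt0.
have /andP[t0 _] := thpi n.
by have := Xfun_decr wn t0 h d1; rewrite -hth => /(lt_trans hn); rewrite ltxx.
Qed.

Lemma theta_cvg k c x t0 (th e : nat -> R) :
  (forall t, 0 < t < pi -> 0 < k + c * t) -> (forall n, 0 < e n) ->
  e @ \oo --> (0 : R) -> (forall n, 0 < th n < pi) ->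
  (forall n, x = Xfun (k + e n) c (th n)) ->
  0 < t0 < pi -> x = Xfun k c t0 -> th @ \oo --> t0.
Proof.
move=> wpos e0 ecv thpi hth /andP[t00 t0pi] xE.
apply/cvgrPdist_lt => d d0.
(* Half the minimum, so that [t0 - r] and [t0 + r] are still angles in [(0, pi)]. *)
pose r := Num.min d (Num.min t0 (pi - t0)) / 2.
have m0 : 0 < Num.min d (Num.min t0 (pi - t0)) by rewrite !lt_min d0 t00 subr_gt0.
have r0 : 0 < r by rewrite divr_gt0.
have rm : r < Num.min d (Num.min t0 (pi - t0)) by rewrite ltr_pdivrMr // ltr_pMr // ltr1n.
move: rm; rewrite !lt_min => /and3P[rd rt rp].
have l1 : 0 < t0 - r < pi by apply/andP; split; lra.
have l2 : 0 < t0 + r < pi by apply/andP; split; lra.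
have h1 : x < Xfun k c (t0 - r) by rewrite xE; apply: Xfun_decr => //; lra.
have h2 : Xfun k c (t0 + r) < x by rewrite xE; apply: Xfun_decr => //; lra.
have n1 := theta_lower wpos e0 ecv thpi hth l1 h1.
have n2 := theta_upper wpos e0 ecv thpi hth l2 h2.
near=> n.
have a1 : t0 - r < th n by near: n.
have a2 : th n < t0 + r by near: n.
by rewrite ltr_norml; apply/andP; split; lra.
Unshelve. all: by end_near.
Qed.

(** This is [- Im (1 / z)] for [z = (k + c t) (cot t + i)]; it becomes a probability density after
    division by pi. *)
Definition polar_density k c t : R := sin t ^+ 2 / (k + c * t).

Lemma polar_density_cvg k c x t0 (th e : nat -> R) :
  (forall t, 0 < t < pi -> 0 < k + c * t) -> (forall n, 0 < e n) ->
  e @ \oo --> (0 : R) -> (forall n, 0 < th n < pi) ->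
  (forall n, x = Xfun (k + e n) c (th n)) ->
  0 < t0 < pi -> x = Xfun k c t0 ->
  polar_density (k + e n) c (th n) @[n --> \oo] --> polar_density k c t0.
Proof.
move=> wpos e0 ecv thpi hth t0pi xE.
have tcv := theta_cvg wpos e0 ecv thpi hth t0pi xE.
have sc : sin (th n) @[n --> \oo] --> sin t0 by apply: (cvg_comp _ _ tcv); exact: continuous_sin.
rewrite /polar_density; apply: cvgM.
  by under eq_fun do rewrite expr2; rewrite expr2; exact: cvgM.
apply: cvgV; first by rewrite gt_eqF // wpos.
apply: cvgD; last by apply: cvgM => //; exact: cvg_cst.
have := cvgD (cvg_cst k : cst k @ \oo --> k) ecv; rewrite addr0; exact.
Qed.

(** From [sin t <= t]. The bound serves twice: uniformly on [(0, pi)], and for the decay as [t]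
    tends to 0. *)
Lemma polar_density0_le c t e : 0 < c -> 0 < t < pi -> 0 <= e ->
  0 <= polar_density e c t <= t / c.
Proof.
move=> c0 /[dup] tpi /andP[t0 _] e0; have s0 := sin_gt0_pi tpi.
have w0 : 0 < e + c * t by rewrite ltr_wpDl // mulr_gt0.
rewrite divr_ge0 ?sqr_ge0 ?(ltW w0) //= ler_pdivrMr //.
have st := sin_le_id (ltW t0).
apply: (@le_trans _ _ (t ^+ 2)); first by apply: lerXn2r; rewrite ?nnegrE // ltW.
rewrite -[t / c * _]mulrA mulrDr [c^-1 * (c * t)]mulrA mulVf ?gt_eqF // mul1r mulrDr expr2.
by rewrite lerDr !mulr_ge0 ?invr_ge0 // ltW.
Qed.

(** Since [X] stays below [x], [theta_upper] puts the angles eventually below every [d]; they tend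
    to 0 and take the density with them. The supremum of [X] is not attained, so [x] may be the edge
    itself. *)
Lemma polar_density_cvg0 c x (th e : nat -> R) : 0 < c -> (forall n, 0 < e n) ->
  e @ \oo --> (0 : R) -> (forall n, 0 < th n < pi) ->
  (forall n, x = Xfun (0 + e n) c (th n)) ->
  (forall t, 0 < t < pi -> Xfun 0 c t < x) ->
  polar_density (0 + e n) c (th n) @[n --> \oo] --> (0 : R).
Proof.
move=> c0 e0 ecv thpi hth hx.
have tcv : th @ \oo --> (0 : R).
  apply/cvgrPdist_lt => d d0.
  have l : 0 < Num.min d (pi / 2) < pi.
    rewrite lt_min d0 divr_gt0 ?pi_gt0 //= gt_min; apply/orP; right.
    by rewrite ltr_pdivrMr // ltr_pMr ?pi_gt0 // ltr1n.
  have := theta_upper (wpos0 c0) e0 ecv thpi hth l (hx _ l).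
  apply: filterS => n; rewrite lt_min => /andP[h _].
  by rewrite sub0r normrN gtr0_norm //; have /andP[] := thpi n.
apply: (@squeeze_cvgr _ _ _ _ (fun=> 0) (fun n => th n / c)).
- by apply: nearW => n; apply: polar_density0_le => //; rewrite add0r ltW.
- exact: cvg_cst.
- have := cvgM tcv (cvg_cst c^-1 : cst c^-1 @ \oo --> c^-1); rewrite mul0r; exact.
Qed.

End BoundaryLimit.

(** * Measures given by a density *)

Section DensityMeasure.
Context d (T : measurableType d) (R : realType) (m : {measure set T -> \bar R}).
Variable f : T -> R.
Hypotheses (mf : measurable_fun [set: T] f) (f0 : forall x, 0 <= f x).

(** The two proofs are arguments of the definition so that the measure structure can be attached to
    the term itself. *)
Definition density_measure of measurable_fun [set: T] f & (forall x, 0 <= f x) :=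
  fun A : set T => (\int[m]_(x in A) (f x)%:E)%E.
Local Notation dm := (density_measure mf f0).

Let dm0 : dm set0 = 0%E.
Proof. exact: integral_set0. Qed.

Let dm_ge0 A : (0 <= dm A)%E.
Proof. by apply: integral_ge0 => x _; rewrite lee_fin. Qed.

Let dm_additive : semi_sigma_additive dm.
Proof.
move=> A mA tA mUA; rewrite /density_measure ge0_integral_bigcup //.
- by apply: is_cvg_ereal_nneg_natsum_cond => n _ _; exact: dm_ge0.
- by apply: measurable_funTS; exact/measurable_EFinP.
- by move=> x _; rewrite lee_fin.
Qed.

HB.instance Definition _ := isMeasure.Build _ _ _ dm dm0 dm_ge0 dm_additive.

End DensityMeasure.

(** * Stieltjes inversion for a bounded limit *)

Section StieltjesInversion.
Variables (R : realType) (nu : probability (measurableTypeR R) R).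
Local Notation leb := (@lebesgue_measure R).

(** Pi times the Poisson kernel of the half-plane; accordingly [smoothed] is pi times the
    convolution of [nu] with this kernel. *)
Definition poisson (e u : R) : R := e / (u ^+ 2 + e ^+ 2).

Definition smoothed (e x : R) : R := - Im (cauchy_transform nu (x +i* e)).

Lemma poisson_gt0 e u : 0 < e -> 0 < poisson e u.
Proof. by move=> e0; rewrite divr_gt0 // ltr_wpDl ?sqr_ge0 // exprn_gt0. Qed.

Lemma continuous_poisson e : 0 < e -> continuous (poisson e).
Proof.
move=> e0 u; apply: cvgM; first exact: cvg_cst.
apply: cvgV; first by rewrite gt_eqF // ltr_wpDl ?sqr_ge0 // exprn_gt0.
by apply: cvgD; [under eq_fun do rewrite expr2; rewrite expr2; apply: cvgM; exact: cvg_id|exact: cvg_cst].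
Qed.

Lemma smoothedE e x : 0 < e ->
  (smoothed e x)%:E = (\int[nu]_t (poisson e (x - t))%:E)%E.
Proof.
move=> e0; have h0 : 0 < Im (x +i* e) by [].
have [_ ii] := cbounded_integrable nu (cbounded_kernel h0).
have E t : -1 * Im (x +i* e - t%:C)^-1 = poisson e (x - t).
  by rewrite mulN1r Im_invc Im_shift Re_shift /= mulNr opprK.
have -> : smoothed e x = \int[nu]_t poisson e (x - t).
  rewrite /smoothed cauchy_cint /= -[LHS]mulN1r -RintegralZl //.
  by apply: eq_Rintegral => t _; rewrite E.
rewrite fineK //; apply: integrable_fin_num => //.
have := integrableZl measurableT (-1) ii.
by apply: eq_integrable => //= t _; rewrite -E EFinM.
Qed.

Lemma measurable_poisson2 e : 0 < e -> measurable_fun [set: measurableTypeR R * measurableTypeR R]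
  (fun p => poisson e (p.1 - p.2)).
Proof.
move=> e0; apply: (measurableT_comp (continuous_measurable_fun (continuous_poisson e0))).
by apply: measurable_funB; [exact: measurable_fst|exact: measurable_snd].
Qed.

Lemma der_atan_poisson (e t x : R) : 0 < e ->
  is_derive x 1 (fun y => atan ((y - t) / e)) (poisson e (x - t)).
Proof.
move=> e0; have d1 := derM (derB (der_id x) (der_cst t x)) (der_cst e^-1 x).
apply: der_ext (der_comp (f := @atan R) (x := x) (g := fun y => (y - t) * e^-1) (is_derive1_atan _) d1) _ _ => //.
rewrite /poisson; field.
by rewrite !gt_eqF // ltr_wpDl ?sqr_ge0 // ?exprn_gt0.
Qed.

Lemma integral_poisson e t a b : 0 < e -> a < b ->
  (\int[leb]_(x in `[a, b]) (poisson e (x - t))%:E)%E =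
  (atan ((b - t) / e) - atan ((a - t) / e))%:E.
Proof.
move=> e0 ab; have hd x := der_atan_poisson t x e0.
rewrite (@continuous_FTC2 R (fun x => poisson e (x - t)) (fun y => atan ((y - t) / e)) a b ab) //.
- apply: continuous_in_subspaceT => x _.
  apply: (@continuous_comp R R R (fun y => y - t) (poisson e)); last exact: continuous_poisson.
  by apply: cvgB; [exact: cvg_id|exact: cvg_cst].
- split.
  + by move=> x _; case: (hd x).
  + by apply: cvg_at_right_filter; exact: der_continuous (hd a).
  + by apply: cvg_at_left_filter; exact: der_continuous (hd b).
- by move=> x _; rewrite derive1E; case: (hd x).
Qed.

(** By Tonelli's theorem the kernel is integrated in [x] first, with antiderivative
    [atan ((x - t) / e)]. *)
Lemma integral_smoothed e a b : 0 < e -> a < b ->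
  (\int[leb]_(x in `[a, b]) (smoothed e x)%:E)%E =
  (\int[nu]_t (atan ((b - t) / e) - atan ((a - t) / e))%:E)%E.
Proof.
move=> e0 ab.
pose D : set (measurableTypeR R) := `[a, b]%classic.
have mD : measurable D by exact: measurable_itv.
pose f (p : measurableTypeR R * measurableTypeR R) : \bar R :=
  ((\1_D p.1) * poisson e (p.1 - p.2))%:E.
have mf : measurable_fun setT f.
  apply/measurable_EFinP; apply: measurable_funM; last exact: measurable_poisson2.
  by apply: measurableT_comp measurable_fst; exact: measurable_indic.
have f0 p : (0 <= f p)%E by rewrite lee_fin mulr_ge0 // ltW // poisson_gt0.
have FT := @fubini_tonelli _ _ (measurableTypeR R) (measurableTypeR R) R leb nu f mf f0.
transitivity (\int[leb]_x \int[nu]_t f (x, t))%E.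
  rewrite integral_mkcond; apply: eq_integral => x _.
  rewrite /f /= epatch_indic /= indicE.
  case: (boolP (x \in D)) => xD; rewrite ?mule1 ?mule0 /=.
    by rewrite smoothedE //; apply: eq_integral => t _; rewrite mul1r.
  by rewrite integral0_eq // => t _; rewrite mul0r.
rewrite FT; apply: eq_integral => t _.
rewrite -integral_poisson // [RHS]integral_mkcond; apply: eq_integral => x _.
rewrite /f /= epatch_indic /= indicE.
by case: (boolP (x \in D)) => xD; rewrite ?mule1 ?mule0 /= ?mul1r ?mul0r.
Qed.

Lemma cvg_atan_sg (s : R) : atan (s / harmonic n) @[n --> \oo] --> pi / 2 * Num.sg s.
Proof.
have pos (r : R) : 0 < r -> atan (r / harmonic n) @[n --> \oo] --> pi / 2.
  move=> r0; apply: (cvg_comp (fun n => r / harmonic n) (@atan R) _ (@cvgy_atan R)).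
  apply/cvgryPge => A; near=> n.
  rewrite /harmonic invrK mulrC -ler_pdivrMr //.
  have : A / r <= n%:R by near: n; exact: nbhs_infty_ger.
  by move=> /le_trans; apply; rewrite ler_nat.
have [s0|s0|->] := ltgtP s 0; last first.
- rewrite sgr0 mulr0 (_ : (fun _ => _) = fun=> 0); first exact: cvg_cst.
  by apply/funext => n; rewrite mul0r atan0.
- by rewrite gtr0_sg // mulr1; exact: pos.
- rewrite ltr0_sg // mulrN1 (_ : (fun _ => _) = fun n => - atan (- s / harmonic n)).
    by apply: cvgN; apply: pos; rewrite oppr_gt0.
  by apply/funext => n; rewrite mulNr atanN opprK.
Unshelve. all: by end_near.
Qed.

Variables (q : R -> R) (C : R).
Hypothesis smoothed_cvg : forall x, smoothed (harmonic n) x @[n --> \oo] --> q x.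
Hypothesis smoothed_le : forall n x, smoothed (harmonic n) x <= C.

Lemma harmonic_gt0R n : 0 < harmonic n :> R.
Proof. exact: harmonic_gt0. Qed.

Lemma smoothed_ge0 e x : 0 < e -> 0 <= smoothed e x.
Proof.
by move=> e0; rewrite -lee_fin smoothedE // integral_ge0 // => t _; rewrite lee_fin ltW // poisson_gt0.
Qed.

Lemma limit_ge0 x : 0 <= q x.
Proof.
rewrite leNgt; apply/negP => h.
have sx : smoothed (harmonic n) x @[n --> \oo] --> q x := @smoothed_cvg x.
have [n] := filter_ex (cvgr_lt _ sx _ h).
by rewrite ltNge smoothed_ge0 // harmonic_gt0R.
Qed.

Lemma limit_le x : q x <= C.
Proof.
rewrite leNgt; apply/negP => h.
have sx : smoothed (harmonic n) x @[n --> \oo] --> q x := @smoothed_cvg x.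
have [n] := filter_ex (cvgr_gt _ sx _ h).
by rewrite ltNge smoothed_le.
Qed.

Lemma measurable_smoothed e : 0 < e ->
  measurable_fun [set: measurableTypeR R] (smoothed e).
Proof.
move=> e0; apply/measurable_EFinP.
rewrite (_ : _ \o _ = fun x => (\int[nu]_t (poisson e (x - t))%:E)%E); last first.
  by apply/funext => x; rewrite /= smoothedE.
apply: (@measurable_fun_fubini_tonelli_F _ _ (measurableTypeR R) (measurableTypeR R) R nu
  (fun p => (poisson e (p.1 - p.2))%:E)).
  by apply/measurable_EFinP; exact: measurable_poisson2.
by move=> p; rewrite lee_fin ltW // poisson_gt0.
Qed.

Lemma measurable_limit : measurable_fun [set: measurableTypeR R] q.
Proof.
apply: (measurable_fun_cvg (h := fun n => smoothed (harmonic n))).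
  by move=> n; apply: measurable_smoothed; exact: harmonic_gt0R.
by move=> x _; exact: smoothed_cvg.
Qed.

(** Both sides of [integral_smoothed] pass to the limit by dominated convergence, the left under the
    constant [C] on a bounded interval, the right under the constant pi. *)
Lemma integral_limit a b : a < b ->
  (\int[leb]_(x in `[a, b]) (q x)%:E)%E =
  (\int[nu]_t (pi / 2 * (Num.sg (b - t) - Num.sg (a - t)))%:E)%E.
Proof.
move=> ab.
have mab : measurable (`[a, b]%classic : set (measurableTypeR R)) by exact: measurable_itv.
have L : (\int[leb]_(x in `[a, b]) (smoothed (harmonic n) x)%:E)%E @[n --> \oo] -->
    (\int[leb]_(x in `[a, b]) (q x)%:E)%E.
  apply: (@dominated_cvg _ _ _ leb `[a, b]%classic mab
     (fun n x => (smoothed (harmonic n) x)%:E) (fun x => (q x)%:E) (fun=> C%:E)).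
  - move=> n; apply: measurable_funTS; apply/measurable_EFinP.
    by apply: measurable_smoothed; exact: harmonic_gt0R.
  - by move=> x _; apply/fine_cvgP; split; [exact: nearW|exact: smoothed_cvg].
  - by [].
  - apply: (@measurable_bounded_integrable _ _ _ leb (fun=> C)) => //.
      have := @lebesgue_measure_itv R `[a, b]; rewrite /= lte_fin ab -EFinD => ->.
      exact: ltry.
    by exists `|C|; split; rewrite ?num_real // => K CK x _ /=; exact: ltW.
  - move=> n x _ /=; rewrite lee_fin ger0_norm; first exact: smoothed_le.
    by apply: smoothed_ge0; exact: harmonic_gt0R.
have Rr : (\int[nu]_t (atan ((b - t) / harmonic n) - atan ((a - t) / harmonic n))%:E)%E @[n --> \oo] -->
    (\int[nu]_t (pi / 2 * (Num.sg (b - t) - Num.sg (a - t)))%:E)%E.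
  apply: (@dominated_cvg _ _ _ nu setT measurableT
     (fun n t => (atan ((b - t) / harmonic n) - atan ((a - t) / harmonic n))%:E)
     (fun t => (pi / 2 * (Num.sg (b - t) - Num.sg (a - t)))%:E) (fun=> pi%:E)).
  - move=> n; apply/measurable_EFinP; apply: continuous_measurable_fun => t.
    have ca (s : R) : {for t, continuous (fun t : R => atan ((s - t) / harmonic n))}.
      apply: (continuous_comp (f := fun t => (s - t) / harmonic n)); last exact: continuous_atan.
      by apply: cvgM; [apply: cvgB; [exact: cvg_cst|exact: cvg_id]|exact: cvg_cst].
    by apply: cvgB; exact: ca.
  - move=> t _; apply/fine_cvgP; split; first exact: nearW.
    by rewrite mulrBr; apply: cvgB; exact: cvg_atan_sg.
  - by [].
  - have muT : (nu [set: measurableTypeR R] < +oo)%E by rewrite probability_setT ltry.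
    apply: (@measurable_bounded_integrable _ _ _ nu (fun=> pi)) => //.
    by exists `|pi|; split; rewrite ?num_real // => K CK x _ /=; exact: ltW.
  - move=> n t _ /=; rewrite lee_fin; apply: le_trans (ler_normB _ _) _.
    have h (u : R) : `|atan u| <= pi / 2.
      by rewrite ler_norml; have := atan_gtNpi2 u; have := atan_ltpi2 u => /ltW -> /ltW ->.
    by rewrite [leRHS]splitr lerD.
move: L; under eq_fun do rewrite integral_smoothed ?harmonic_gt0R //.
by move=> L; apply: (cvg_unique _ L Rr).
Qed.


Lemma integral_indicZ (k : R) (A : set (measurableTypeR R)) : 0 <= k -> measurable A ->
  (\int[nu]_t (k * \1_A t)%:E)%E = (k%:E * nu A)%E.
Proof.
move=> k0 mA; under eq_integral do rewrite EFinM.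
rewrite ge0_integralZl_EFin //.
  by rewrite integral_indic // setIT.
by apply/measurable_EFinP; exact: measurable_indic.
Qed.

Lemma measurable_sg_kernel a b : measurable_fun [set: measurableTypeR R]
  (fun t : R => (pi / 2 * (Num.sg (b - t) - Num.sg (a - t)))%:E).
Proof.
have msg : forall s, measurable_fun [set: measurableTypeR R] (fun t : R => Num.sg (s - t)).
  move=> s; apply: (@measurable_fun_cvg _ (measurableTypeR R) R setT
    (fun n t => 2 / pi * atan ((s - t) / harmonic n))).
    move=> n; apply: measurable_funM => //.
    apply: continuous_measurable_fun => t.
    apply: (continuous_comp (f := fun t => (s - t) / harmonic n)); last exact: continuous_atan.
    by apply: cvgM; [apply: cvgB; [exact: cvg_cst|exact: cvg_id]|exact: cvg_cst].
  move=> t _.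
  have st : atan ((s - t) / harmonic n) @[n --> \oo] --> pi / 2 * Num.sg (s - t) by exact: cvg_atan_sg.
  have := cvgM (cvg_cst (2 / pi) : cst (2 / pi) @ \oo --> 2 / pi) st.
  rewrite mulrA mulf_div [2 * pi]mulrC divff ?mul1r; first exact.
  by rewrite mulf_neq0 // pi_neq0.
apply/measurable_EFinP; apply: measurable_funM => //.
exact: measurable_funB.
Qed.

(** The difference of signs is 2 inside the interval, 1 at its endpoints and 0 outside. *)
Lemma sg_kernel_le (a b t : R) : a < b ->
  2 * \1_(`]a, b[%classic : set R) t <= Num.sg (b - t) - Num.sg (a - t) <=
  2 * \1_(`[a, b]%classic : set R) t.
Proof.
move=> ab; have E (i : interval R) : (t \in [set` i]) = (t \in i) by apply/idP/idP => [/set_mem|h]; [|exact/mem_set].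
rewrite !indicE !E !in_itv /=.
have [ta|ta|<-] := ltgtP a t.
- rewrite [Num.sg (a - t)]ltr0_sg ?subr_lt0 // opprK.
  have [tb|tb|->] := ltgtP t b.
  + by rewrite gtr0_sg ?subr_gt0 //=; apply/andP; split; lra.
  + by rewrite ltr0_sg ?subr_lt0 //=; apply/andP; split; lra.
  + by rewrite subrr sgr0 /=; apply/andP; split; lra.
- rewrite [Num.sg (a - t)]gtr0_sg ?subr_gt0 // [Num.sg (b - t)]gtr0_sg ?subr_gt0 ?(lt_trans ta) //=.
  by apply/andP; split; lra.
- by rewrite subrr sgr0 gtr0_sg ?subr_gt0 // ab (ltW ab) /=; apply/andP; split; lra.
Qed.

Lemma nu_itv_bounds a b : a < b ->
  (pi%:E * nu `]a, b[%classic <= \int[leb]_(x in `[a, b]) (q x)%:E)%E /\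
  (\int[leb]_(x in `[a, b]) (q x)%:E <= pi%:E * nu `[a, b]%classic)%E.
Proof.
move=> ab; have p0 := pi_ge0 R.
have mA : measurable (`]a, b[%classic : set (measurableTypeR R)) by exact: measurable_itv.
have mB : measurable (`[a, b]%classic : set (measurableTypeR R)) by exact: measurable_itv.
have mi (A : set (measurableTypeR R)) : measurable A ->
    measurable_fun [set: measurableTypeR R] (fun t : R => (pi * \1_A t)%:E).
  by move=> hA; apply/measurable_EFinP; apply: measurable_funM => //; exact: measurable_indic.
have kE (t : R) : pi * t = pi / 2 * (2 * t) by rewrite mulrA divfK.
rewrite integral_limit // -!integral_indicZ //; split; apply: ge0_le_integral => //.
- by move=> t _; rewrite lee_fin mulr_ge0.
- exact: mi.
- exact: measurable_sg_kernel.
- by move=> t _; rewrite lee_fin (kE (\1_ _ _)) ler_wpM2l ?divr_ge0 //; have /andP[] := sg_kernel_le t ab.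
- move=> t _; rewrite lee_fin mulr_ge0 ?divr_ge0 //; have /andP[h _] := sg_kernel_le t ab.
  by apply: le_trans h; rewrite mulr_ge0.
- exact: measurable_sg_kernel.
- exact: mi.
- by move=> t _; rewrite lee_fin (kE (\1_ _ _)) ler_wpM2l ?divr_ge0 //; have /andP[] := sg_kernel_le t ab.
Qed.

Lemma integral_limit_le a b : a < b ->
  (\int[leb]_(x in `[a, b]) (q x)%:E <= (C * (b - a))%:E)%E.
Proof.
move=> ab.
have mab : measurable (`[a, b]%classic : set (measurableTypeR R)) by exact: measurable_itv.
apply: (@le_trans _ _ (\int[leb]_(x in `[a, b]) (C%:E))%E).
  apply: ge0_le_integral => //.
  - by move=> x _; rewrite lee_fin limit_ge0.
  - by apply: measurable_funTS; apply/measurable_EFinP; exact: measurable_limit.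
  - by move=> x _; rewrite lee_fin limit_le.
rewrite integral_cst //.
have := @lebesgue_measure_itv R `[a, b]; rewrite /= lte_fin ab -EFinD => ->.
by rewrite -EFinM.
Qed.

(** By the bound [C], the open interval of length [2 d] around [a] has measure at most
    [2 C d / pi]. *)
Lemma nu_atom (a : R) : nu [set a] = 0%E.
Proof.
have p0 := pi_gt0 R.
have ma : measurable ([set a] : set (measurableTypeR R)) by exact: measurable_set1.
have C0 : 0 <= C by exact: le_trans (limit_ge0 0) (limit_le 0).
have h (d : R) : 0 < d -> (pi%:E * nu [set a] <= (C * (2 * d))%:E)%E.
  move=> d0; have ab : a - d < a + d by lra.
  have [h1 _] := nu_itv_bounds ab; have h2 := integral_limit_le ab.
  apply: (@le_trans _ _ (pi%:E * nu `](a - d)%R, (a + d)%R[%classic)%E).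
    apply: lee_wpmul2l; first by rewrite lee_fin ltW.
    apply: le_measure; rewrite ?inE //.
    by move=> x /= ->; rewrite in_itv /=; apply/andP; split; lra.
  apply: le_trans h1 (le_trans h2 _).
  by rewrite lee_fin ler_wpM2l //; lra.
have : (pi%:E * nu [set a] <= 0)%E.
  apply/lee_addgt0Pr => e e0; rewrite add0e.
  (* With this [d], [C (2 d) = C e / (C + 1) <= e]; the added 1 covers [C = 0]. *)
  have d0 : 0 < e / (C + 1) / 2 by rewrite !divr_gt0 // ltr_wpDl.
  apply: le_trans (h _ d0) _; rewrite lee_fin [2 * _]mulrC divfK // mulrA ler_pdivrMr ?ltr_wpDl //.
  by rewrite mulrC ler_pM2l // lerDl.
move=> h0; apply/eqP; rewrite eq_le measure_ge0 andbT.
by rewrite -(@lee_pmul2l _ pi%:E) ?lte_fin // mule0.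
Qed.

Lemma nu_itv a b : a < b ->
  (pi%:E * nu `]a, b]%classic = \int[leb]_(x in `[a, b]) (q x)%:E)%E.
Proof.
move=> ab; have [h1 h2] := nu_itv_bounds ab.
have p0 : (0 <= pi%:E :> \bar R)%E by rewrite lee_fin pi_ge0.
have moo : measurable (`]a, b[%classic : set (measurableTypeR R)) by exact: measurable_itv.
have moc : measurable (`]a, b]%classic : set (measurableTypeR R)) by exact: measurable_itv.
have mS x : measurable ([set x] : set (measurableTypeR R)) by exact: measurable_set1.
apply/eqP; rewrite eq_le; apply/andP; split.
  apply: le_trans h1; apply: lee_wpmul2l => //.
  have -> : `]a, b]%classic = `]a, b[%classic `|` [set b] by rewrite setUitv1 // bnd_simp.
  apply: le_trans (measureU2 _ _ _) _ => //.
  by rewrite [X in (_ + X <= _)%E](_ : _ = 0%E) ?adde0 //; exact: nu_atom.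
apply: le_trans h2 _; apply: lee_wpmul2l => //.
have -> : `[a, b]%classic = [set a] `|` `]a, b]%classic by rewrite setU1itv // bnd_simp ltW.
apply: le_trans (measureU2 _ _ _) _ => //.
by rewrite [X in (X + _ <= _)%E](_ : _ = 0%E) ?add0e //; exact: nu_atom.
Qed.

Lemma measurable_limit_pi : measurable_fun [set: measurableTypeR R] (fun x => q x / pi).
Proof. by apply: measurable_funM => //; exact: measurable_limit. Qed.

Lemma limit_pi_ge0 x : 0 <= q x / pi.
Proof. by rewrite divr_ge0 ?limit_ge0 ?pi_ge0. Qed.

(** Half-open intervals are closed under intersection and generate the Borel sets, and []- k, k]]
    exhaust the line with finite measure, so agreement on them is enough. *)
Theorem stieltjes_inversion (A : set (measurableTypeR R)) : measurable A ->
  nu A = (\int[leb]_(x in A) (q x / pi)%:E)%E.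
Proof.
move=> mA.
have key (X : set (measurableTypeR R)) : ocitv X ->
    nu X = density_measure leb measurable_limit_pi limit_pi_ge0 X.
  move=> /ocitvP[->|[[a b] /= ab ->]]; first by rewrite !measure0.
  have mab : measurable (`[a, b]%classic : set (measurableTypeR R)) by exact: measurable_itv.
  have mq : measurable_fun setT (fun x => (q x / pi)%:E).
    by apply/measurable_EFinP; exact: measurable_limit_pi.
  rewrite /density_measure integral_itv_obnd_cbnd; last exact: measurable_funTS.
  under eq_integral do rewrite mulrC EFinM.
  rewrite ge0_integralZl_EFin //.
  - rewrite -nu_itv // muleA -EFinM mulVf ?pi_neq0 // mul1e //.
  - by move=> x _; rewrite lee_fin limit_ge0.
  - by apply: measurable_funTS; apply/measurable_EFinP; exact: measurable_limit.
  - by rewrite invr_ge0 pi_ge0.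
rewrite -[RHS]/(density_measure leb measurable_limit_pi limit_pi_ge0 A).
have U := @measure_unique _ R (measurableTypeR R) (@ocitv R) (fun k => `](- k%:R), k%:R]%classic)
  erefl (@ocitvI R) _ (bigcup_itvT _ _) nu (density_measure leb measurable_limit_pi limit_pi_ge0) key.
apply: U => //.
  by move=> k; exact: is_ocitv.
by move=> k; apply: (le_lt_trans (probability_le1 nu _)) => //; rewrite ltry.
Qed.

End StieltjesInversion.

(** * Analyticity from bounds on all derivatives *)

Section TaylorSeries.
Variable R : realType.

(** The two conditions on [s] describe the segment between [x] and [y] whatever their order. *)
Lemma mean_value_bound (f df : R -> R) (x y K : R) :
  (forall s, `|s - x| <= `|y - x| -> `|y - s| <= `|y - x| ->
     is_derive s 1 f (df s) /\ `|df s| <= K) ->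
  `|f y - f x| <= K * `|y - x|.
Proof.
move=> h.
have main (a b : R) : a <= b -> (forall s : R, a <= s <= b -> is_derive s 1 f (df s) /\ `|df s| <= K) ->
    `|f b - f a| <= K * `|b - a|.
  move=> ab hd.
  have hd1 s : a <= s <= b -> is_derive s 1 f (df s) by move=> /hd[].
  have [s hs|s hs ->] := @MVT_segment R f df a b ab _ (der_within_continuous hd1).
    by apply: hd1; move: hs; rewrite in_itv /= => /andP[? ?]; rewrite !ltW.
  by rewrite normrM ler_wpM2r //; move: hs; rewrite in_itv /= => /hd[].
have [xy|/ltW yx] := leP x y.
  apply: main => // s /andP[xs sy]; apply: h; rewrite !ger0_norm ?subr_ge0 //.
    by rewrite lerD2r.
  by rewrite lerD2l lerN2.
rewrite distrC [`|y - x|]distrC; apply: main => // s /andP[ys sx]; apply: h.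
  by rewrite !ler0_norm ?subr_le0 // !opprB lerD2l lerN2.
by rewrite !ler0_norm ?subr_le0 // !opprB lerD2r.
Qed.

(** Here [f n] is the n-th derivative divided by [n!], hence the factor [n.+1]. For fixed [y], the
    Taylor polynomial [phi] as a function of its centre [s] equals [f 0 y] at [s = y] and the
    partial sum at [s = x]; its derivative telescopes to a single term, which the mean value bound
    controls. *)
Lemma analytic_of_derivatives (f : nat -> R -> R) (x r A B : R) :
  0 < r -> 0 <= A -> 0 < B ->
  (forall n y, `|y - x| < r -> is_derive y 1 (f n) (n.+1%:R * f n.+1 y)) ->
  (forall n y, `|y - x| < r -> `|f n y| <= A * B ^+ n) ->
  analytic_at (f 0%N) x.
Proof.
move=> r0 A0 B0 df fb.
(* With [B |y - x| <= 1/4], the error [(N + 1) A (B |y - x|)^(N+1)] is at most [A / 2^(N+1)]. *)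
exists (fun n => f n x), (Num.min r (4 * B)^-1); split.
  by rewrite lt_min r0 invr_gt0 mulr_gt0.
move=> y; rewrite lt_min => /andP[yr yB].
pose phi N s := \sum_(0 <= n < N) f n s * (y - s) ^+ n.
have dphi N s : `|s - x| < r ->
    is_derive s 1 (phi N.+1) (N.+1%:R * f N.+1 s * (y - s) ^+ N).
  move=> sr.
  have dys : is_derive s 1 (fun u => y - u) (- 1).
    by apply: der_ext (derB (der_cst y s) (der_id s)) _ _ => //; rewrite sub0r.
  elim: N => [|N IH].
    apply: der_ext (df 0%N s sr) _ _ => [u|]; last by rewrite expr0 mulr1.
    by rewrite /phi big_nat1 expr0 mulr1.
  apply: der_ext (derD IH (derM (df N.+1 s sr) (derX N dys))) _ _ => [u|].
    by rewrite /phi [RHS]big_nat_recr.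
  by rewrite exprS; ring.
have phiy N : phi N.+1 y = f 0%N y.
  rewrite /phi big_nat_recl // expr0 mulr1 big1 ?addr0 // => i _.
  by rewrite subrr expr0n mulr0.
have err N : `|f 0%N y - series (fun n => f n x * (y - x) ^+ n) N.+1| <= A * 2^-1 ^+ N.+1.
  have -> : series (fun n => f n x * (y - x) ^+ n) N.+1 = phi N.+1 x by [].
  rewrite -(phiy N).
  apply: le_trans (mean_value_bound (df := fun s => N.+1%:R * f N.+1 s * (y - s) ^+ N)
    (K := N.+1%:R * (A * B ^+ N.+1) * `|y - x| ^+ N) _) _.
    move=> s sx ys; have sr : `|s - x| < r by exact: le_lt_trans yr.
    split; first exact: dphi.
    rewrite !normrM normrX ger0_norm ?ler0n //; apply: ler_pM => //.
    - by rewrite ler_wpM2l // fb.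
    - by apply: lerXn2r; rewrite ?nnegrE.
  rewrite -mulrA -exprSr -!mulrA mulrCA ler_wpM2l // -exprMn.
  have hB : B * `|y - x| <= 4^-1.
    by move: yB; rewrite -[(4 * B)^-1]mul1r ltr_pdivlMr ?mulr_gt0 // => ?; lra.
  apply: (@le_trans _ _ (2 ^+ N.+1 * 4^-1 ^+ N.+1)).
    apply: ler_pM => //; first by rewrite exprn_ge0 // mulr_ge0 // ltW.
      by rewrite -natrX ler_nat ltnW // ltn_expl.
    by apply: lerXn2r; rewrite ?nnegrE // mulr_ge0 // ltW.
  rewrite -exprMn (_ : 2 * 4^-1 = 2^-1 :> R) //; lra.
rewrite -(cvg_shiftS _); apply/cvgrPdist_le => e e0.
have g0 : (A * 2^-1 ^+ n : R) @[n --> \oo] --> (0 : R).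
  have h2 : `|2^-1 : R| < 1 by rewrite gtr0_norm ?invr_gt0 // invf_lt1 // ltr1n.
  have := cvgM (cvg_cst A : cst A @ \oo --> A) (cvg_expr h2); rewrite mulr0; exact.
move: g0; rewrite -(cvg_shiftS _) => /cvgrPdist_le /(_ _ e0).
apply: filterS => n; rewrite sub0r normrN => h; apply: le_trans (err n) _.
exact: le_trans (ler_norm _) h.
Qed.

Lemma analytic_at_near (f g : R -> R) (x r : R) : 0 < r ->
  (forall y, `|y - x| < r -> f y = g y) -> analytic_at f x -> analytic_at g x.
Proof.
move=> r0 fg [a [r' [r'0 h]]]; exists a, (Num.min r r'); split.
  by rewrite lt_min r0.
by move=> y; rewrite lt_min => /andP[h1 h2]; rewrite -fg //; exact: h.
Qed.

End TaylorSeries.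

(** * The derivatives of 1 / z along the boundary curve *)

Section AnalyticBoundary.
Variable R : realType.
Local Notation C := R[i].
Variables (z : R -> C) (c : R).
Local Notation g := (fun y => (z y)^-1).
Local Notation al := (fun y => (z y - c%:C)^-1).
Local Notation q := (fun y => z y * (z y - c%:C)^-1 ^+ 2).

(* [(a, (j, k))] stands for the monomial [a g al^j q^k]; the monomials of degree
   [j + k = n] make up the [n]-th derivative of [g], up to the factor [n!]. *)
Definition monoms := seq (C * (nat * nat)).

Definition eval_monoms (s : monoms) (y : R) : C :=
  \sum_(m <- s) m.1 * (g y * (al y ^+ m.2.1 * q y ^+ m.2.2)).

(** The monomial [g al^j q^k] has derivative [(k - 1) g al^(j+1) q^k - (j + 2 k) g al^j q^(k+1)];
    dividing by [n.+1] maintains the normalisation by [n!]. *)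
Definition deriv_monoms (n : nat) (s : monoms) : monoms :=
  [seq (m.1 * (m.2.2%:R - 1) / n.+1%:R, (m.2.1.+1, m.2.2)) | m <- s] ++
  [seq (- m.1 * (m.2.1 + m.2.2.*2)%:R / n.+1%:R, (m.2.1, m.2.2.+1)) | m <- s].

Fixpoint taylor_monoms (n : nat) : monoms :=
  if n is n'.+1 then deriv_monoms n' (taylor_monoms n') else [:: (1, (0%N, 0%N))].

Definition weight (s : monoms) : R := \sum_(m <- s) normc m.1.

Lemma mul_div_split (N a b u v : C) : N != 0 ->
  a * u + b * v = N * (a / N * u + b / N * v).
Proof. by move=> N0; field. Qed.

Lemma natrC_neq0 n : n.+1%:R != 0 :> C.
Proof. by rewrite pnatr_eq0. Qed.

Lemma taylor_monoms_deg n m : m \in taylor_monoms n -> (m.2.1 + m.2.2)%N = n.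
Proof.
elim: n m => [|n IH] m /=; first by rewrite inE => /eqP ->.
by rewrite mem_cat => /orP[] /mapP[m' /IH h ->] /=; rewrite ?addSn ?addnS h.
Qed.

Lemma normc_nat n : normc (n%:R : C) = n%:R.
Proof. by rewrite -[n%:R](rmorph_nat (real_complex R)) normc_real ger0_norm. Qed.

(** A monomial with [j + k = n] produces two whose coefficients add up in modulus to at most
    [((k + 1) + (j + 2 k)) / (n + 1) <= 3] times its own: the division by [n + 1] compensates the
    growth of the exponents. *)
Lemma weight_taylor n : weight (taylor_monoms n) <= 3 ^+ n.
Proof.
elim: n => [|n IH]; first by rewrite /weight big_seq1 ComplexField.Normc.normc1.
rewrite /weight /= big_cat !big_map /= -big_split /=.
apply: (@le_trans _ _ (\sum_(m <- taylor_monoms n) 3 * normc m.1)); last first.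
  by rewrite -mulr_sumr exprS ler_wpM2l.
rewrite big_seq [leRHS]big_seq; apply: ler_sum => m /taylor_monoms_deg hm.
have n0 : 0 < n.+1%:R :> R by rewrite ltr0n.
rewrite !ComplexField.Normc.normcM normc_opp ComplexField.Normc.normcV !normc_nat.
rewrite -!mulrA -mulrDr [3 * _]mulrC ler_wpM2l ?normc_ge0 //.
rewrite -mulrDl ler_pdivrMr //.
apply: (@le_trans _ _ (m.2.2%:R + 1 + (m.2.1 + m.2.2.*2)%:R)).
  rewrite lerD2r; apply: le_trans (normc_leB _ _) _.
  by rewrite normc_nat ComplexField.Normc.normc1.
rewrite natr1 -!natrD -natrM ler_nat -hm -addnn.
rewrite (_ : (3 * _)%N = (m.2.2.+1 + (m.2.1 + (m.2.2 + m.2.2)) + (m.2.1 + m.2.1 + 2))%N) ?leq_addr //.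
by ring.
Qed.

Variables (x r m0 : R).
Hypotheses (r0 : 0 < r) (m00 : 0 < m0).
Hypothesis Im_lower : forall y, `|y - x| < r -> m0 <= Im (z y).
Hypothesis dz : forall y, `|y - x| < r -> cder z y (z y / (z y - c%:C)).

Lemma Imz_gt0 y : `|y - x| < r -> 0 < Im (z y).
Proof. by move=> /Im_lower; exact: lt_le_trans. Qed.

Lemma z_neq0 y : `|y - x| < r -> z y != 0.
Proof. by move=> /Imz_gt0 /Im_gt0_neq0. Qed.

Lemma zc_neq0 y : `|y - x| < r -> z y - c%:C != 0.
Proof. by move=> h; rewrite Im_gt0_neq0 // Im_shift Imz_gt0. Qed.

Lemma cder_g y : `|y - x| < r -> cder g y (- (g y * al y)).
Proof.
move=> h; have z0 := z_neq0 h; have zc := zc_neq0 h.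
by apply: cder_ext (cderV z0 (dz h)) _ _ => //; field; rewrite z0 zc.
Qed.

Lemma cder_al y : `|y - x| < r -> cder al y (- (al y * q y)).
Proof.
move=> h; have z0 := z_neq0 h; have zc := zc_neq0 h.
have d1 := cderV (f := fun y => z y - c%:C) zc (cderB (dz h) (cder_cst c%:C y)).
by apply: cder_ext d1 _ _ => //; field; rewrite zc.
Qed.

Lemma cder_q y : `|y - x| < r -> cder q y (q y * al y - 2 * q y ^+ 2).
Proof.
move=> h; have z0 := z_neq0 h; have zc := zc_neq0 h.
have da := cder_al h.
apply: cder_ext (cderM (dz h) (cderM da da)) _ _ => [u|]; first by rewrite expr2.
by field; rewrite zc.
Qed.

Lemma cderX (f : R -> C) y (d : C) n : cder f y d ->
  cder (fun u => f u ^+ n) y (n%:R * f y ^+ n.-1 * d).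
Proof.
move=> h; elim: n => [|n IH].
  by apply: cder_ext (cder_cst 1 y) _ _; rewrite ?mul0r.
apply: cder_ext (cderM h IH) _ _ => [u|]; first by rewrite exprS.
case: n {IH} => [|n] /=; first by rewrite !expr0 mul1r; ring.
by rewrite exprS -[n.+2%:R]natr1; ring.
Qed.

Lemma cder_monom (a : C) (j k : nat) y : `|y - x| < r ->
  cder (fun u => a * (g u * (al u ^+ j * q u ^+ k))) y
   (a * (k%:R - 1) * (g y * (al y ^+ j.+1 * q y ^+ k)) +
    - a * (j + k.*2)%:R * (g y * (al y ^+ j * q y ^+ k.+1))).
Proof.
move=> h.
apply: cder_ext (cderMl a (cderM (cder_g h) (cderM (cderX j (cder_al h)) (cderX k (cder_q h))))) _ _ => //.
rewrite natrD -mul2n natrM.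
set G := (z y)^-1; set A := (z y - c%:C)^-1; set Q := z y * A ^+ 2.
by case: j => [|j]; case: k => [|k] /=; rewrite ?exprS ?expr0; ring.
Qed.

Lemma cder_eval n y : `|y - x| < r ->
  cder (eval_monoms (taylor_monoms n)) y
    (n.+1%:R * eval_monoms (taylor_monoms n.+1) y).
Proof.
move=> h; rewrite /eval_monoms /= big_cat !big_map /= -big_split /= mulr_sumr.
elim: (taylor_monoms n) => [|[a [j k]] s IH].
  by apply: cder_ext (cder_cst 0 y) _ _ => [u|]; rewrite big_nil.
apply: cder_ext (cderD (cder_monom a j k h) IH) _ _ => [u|]; first by rewrite big_cons.
rewrite [RHS]big_cons /=; congr (_ + _).
exact: mul_div_split (natrC_neq0 n).
Qed.

(** [1 / m0] bounds [|g|], and [M] bounds [|al|] and [|q|], so a monomial of degree [n] is at most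
    [M^n / m0]; the total weight contributes [3^n]. *)
Lemma eval_bound (M : R) n y : 0 <= M -> m0^-1 * (1 + `|c| / m0) <= M ->
  `|y - x| < r -> normc (eval_monoms (taylor_monoms n) y) <= m0^-1 * (3 * M) ^+ n.
Proof.
move=> M0 hM h.
have i0 : 0 <= m0^-1 by rewrite invr_ge0 ltW.
have z0 := z_neq0 h; have zc := zc_neq0 h.
have hg : normc (g y) <= m0^-1.
  by have := @normc_kernel_le R m0 (z y) 0 m00 (Im_lower h); rewrite rmorph0 subr0.
have ha : normc (al y) <= m0^-1 by exact: (normc_kernel_le _ m00 (Im_lower h)).
have hq : normc (q y) <= M.
  (* From [z = (z - c) + c]; it bounds [q] although [z] itself has no upper bound here. *)
  have -> : q y = al y * (1 + c%:C * al y) by field.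
  apply: le_trans hM.
  rewrite ComplexField.Normc.normcM ler_pM ?normc_ge0 //.
  apply: le_trans (normc_leD _ _) _; rewrite ComplexField.Normc.normc1 lerD2l.
  by rewrite ComplexField.Normc.normcM normc_real ler_wpM2l.
have ha' : normc (al y) <= M.
  apply: le_trans ha (le_trans _ hM).
  by rewrite ler_peMr // lerDl divr_ge0 // ltW.
rewrite exprMn mulrA [m0^-1 * _]mulrC -mulrA.
apply: (@le_trans _ _ (weight (taylor_monoms n) * (m0^-1 * M ^+ n))); last first.
  by rewrite ler_wpM2r ?weight_taylor // mulr_ge0 // exprn_ge0.
rewrite /weight mulr_suml /eval_monoms.
have : forall m, m \in taylor_monoms n -> (m.2.1 + m.2.2)%N = n by move=> m; exact: taylor_monoms_deg.
elim: (taylor_monoms n) => [|m s IH] hs.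
  by rewrite !big_nil ComplexField.Normc.normc0.
rewrite !big_cons; apply: le_trans (normc_leD _ _) _; apply: lerD; last first.
  by apply: IH => m' hm'; apply: hs; rewrite inE hm' orbT.
rewrite !ComplexField.Normc.normcM ler_wpM2l ?normc_ge0 // ler_pM ?mulr_ge0 ?normc_ge0 //.
rewrite -(hs m (mem_head _ _)) exprD ler_pM ?normc_ge0 // normcX;
  by apply: lerXn2r; rewrite ?nnegrE ?normc_ge0.
Qed.

Lemma analytic_Im_inv (kappa : R) : analytic_at (fun y => kappa * Im (z y)^-1) x.
Proof.
pose M := Num.max 1 (m0^-1 * (1 + `|c| / m0)).
have M1 : 1 <= M by rewrite le_max lexx.
pose f n y := kappa * Im (eval_monoms (taylor_monoms n) y).
have E y : kappa * Im (z y)^-1 = f 0%N y.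
  by rewrite /f /eval_monoms big_seq1 /= !expr0 !mulr1 mul1r.
apply: (@analytic_at_near _ (f 0%N) _ x r r0) => [y _|]; first by rewrite E.
apply: (@analytic_of_derivatives _ f x r (`|kappa| * m0^-1) (3 * M)) => //.
- by rewrite mulr_ge0 // invr_ge0 ltW.
- by rewrite mulr_gt0 // (lt_le_trans _ M1).
- move=> n y h; have [_ h2] := cder_eval n h.
  apply: der_ext (derMl kappa h2) _ _ => //.
  rewrite /f mulrCA; congr (_ * _).
  by rewrite -[n.+1%:R in LHS](rmorph_nat (real_complex R)) ImM /= mul0r addr0.
- move=> n y h; rewrite /f normrM -mulrA ler_wpM2l //.
  apply: le_trans (ler_normc_Im _) (eval_bound n _ _ h) => //.
  + exact: le_trans M1.
  + by rewrite le_max lexx orbT.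
Qed.

End AnalyticBoundary.

(** * The angle as a function of the boundary abscissa *)

Lemma dist_sqr_polar (K : fieldType) (s co w c : K) : s != 0 -> co ^+ 2 + s ^+ 2 = 1 ->
  (w / s - c * co) ^+ 2 + (c * s) ^+ 2 = (w * (co / s) - c) ^+ 2 + w ^+ 2.
Proof.
move=> s0 h; apply/eqP; rewrite -subr_eq0.
have -> : (w / s - c * co) ^+ 2 + (c * s) ^+ 2 - ((w * (co / s) - c) ^+ 2 + w ^+ 2) =
  (c ^+ 2 - w ^+ 2 / s ^+ 2) * (co ^+ 2 + s ^+ 2 - 1) by field.
by rewrite h subrr mulr0.
Qed.

(** Here [D = |z - c|^2] and [ct = cot theta], so [theta' = - w / D]. The left side is the real part
    of the velocity of [z = w (cot theta + i)], the right side that of [z / (z - c)]; with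
    trigonometric values as variables the identity is rational. *)
Lemma polar_velocity_Re (K : fieldType) (D w ct c : K) : D != 0 -> w != 0 ->
  c / (- D / w) * ct + w * (- (1 + ct ^+ 2) / (- D / w)) =
  w * ct * ((w * ct - c) / D) - w * - (w / D).
Proof. by move=> D0 w0; field; rewrite ?oppr_eq0 ?oner_eq0 ?D0 ?w0. Qed.

Lemma polar_velocity_Im (K : fieldType) (D w ct c : K) : D != 0 -> w != 0 ->
  c / (- D / w) = w * ct * - (w / D) + w * ((w * ct - c) / D).
Proof. by move=> D0 w0; field; rewrite ?oppr_eq0 ?oner_eq0 ?D0 ?w0. Qed.

Section BoundaryAngle.
Variable R : realType.
Implicit Types (k c x y t : R).

(** The default 0 lies outside [(0, pi)]; it is returned exactly where the equation has no
    solution. *)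
Definition boundary_angle k c x : R := xget 0 [set t | 0 < t < pi /\ x = Xfun k c t].

Lemma boundary_angleP k c x : (exists t, 0 < t < pi /\ x = Xfun k c t) ->
  0 < boundary_angle k c x < pi /\ x = Xfun k c (boundary_angle k c x).
Proof. exact: (@xgetPex _ 0 [set t | 0 < t < pi /\ x = Xfun k c t]). Qed.

Variables k c : R.
Hypothesis wpos : forall t, 0 < t < pi -> 0 < k + c * t.
Local Notation th := (boundary_angle k c).
Local Notation w := (fun y => k + c * th y).

Variables x0 r : R.
Hypothesis r0 : 0 < r.
Hypothesis onto : forall y, `|y - x0| < r -> exists t, 0 < t < pi /\ y = Xfun k c t.

Lemma angle_in y : `|y - x0| < r -> 0 < th y < pi.
Proof. by move=> /onto/boundary_angleP[]. Qed.

Lemma angle_eq y : `|y - x0| < r -> Xfun k c (th y) = y.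
Proof. by move=> /onto/boundary_angleP[_ <-]. Qed.

Lemma angle_Xfun t : 0 < t < pi -> th (Xfun k c t) = t.
Proof.
move=> tpi; have [|h1 h2] := @boundary_angleP k c (Xfun k c t); first by exists t.
by apply: (Xfun_inj wpos).
Qed.

Lemma near_in_pi t : 0 < t < pi -> \forall u \near t, 0 < u < pi.
Proof.
by move=> /andP[t0 tp]; near=> u; apply/andP; split; near: u; [exact: lt_nbhsr|exact: lt_nbhsl].
Unshelve. all: by end_near.
Qed.

Lemma der_angle y : `|y - x0| < r -> is_derive y 1 th (dXfun k c (th y))^-1.
Proof.
move=> hy; have tpi := angle_in hy.
have d := der_Xfun tpi (wpos tpi).
rewrite -{1}(angle_eq hy); apply: is_derive_inverse => //.
- by apply: filterS (near_in_pi tpi) => u; exact: angle_Xfun.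
- apply: filterS (near_in_pi tpi) => u hu.
  by have := der_Xfun hu (wpos hu); exact: der_continuous.
- by rewrite lt_eqF // dXfun_lt0 // wpos.
Qed.

Definition boundary_point y : R[i] := (w y * cot (th y)) +i* w y.

Lemma cder_boundary_point y : `|y - x0| < r ->
  cder boundary_point y (boundary_point y / (boundary_point y - c%:C)).
Proof.
move=> hy; have tpi := angle_in hy; have wt := wpos tpi.
have s0 := sin_gt0_pi tpi; have dth := der_angle hy.
have dw : is_derive y 1 w (c * (dXfun k c (th y))^-1).
  by apply: der_ext (derD (der_cst k y) (derMl c dth)) _ _ => //; rewrite add0r.
have dc := der_comp (f := @cot R) (x := y) (g := th) (der_cot tpi) dth.
have sN : sin (th y) != 0 by rewrite gt_eqF.
have wN : w y != 0 by rewrite gt_eqF.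
have D0 : (w y / sin (th y) - c * cos (th y)) ^+ 2 + (c * sin (th y)) ^+ 2 != 0.
  have := dXfun_lt0 tpi wt; rewrite /dXfun mulNr oppr_lt0 => h.
  by apply: contraTneq h => ->; rewrite mul0r ltxx.
have cs := cos2Dsin2 (th y).
have DE : (w y / sin (th y) - c * cos (th y)) ^+ 2 + (c * sin (th y)) ^+ 2 =
    (w y * cot (th y) - c) ^+ 2 + w y ^+ 2.
  exact: dist_sqr_polar.
have E1 : - (sin (th y))^-1 ^+ 2 = - (1 + cot (th y) ^+ 2).
  congr (- _); rewrite /cot.
  have -> : (sin (th y))^-1 ^+ 2 = (cos (th y) ^+ 2 + sin (th y) ^+ 2) * (sin (th y))^-1 ^+ 2.
    by rewrite cs mul1r.
  by field.
split => /=.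
  apply: der_ext (derM dw dc) _ _ => //.
  by rewrite subr0 -DE E1; exact: polar_velocity_Re.
apply: der_ext dw _ _ => //.
by rewrite subr0 -DE; exact: polar_velocity_Im.
Qed.

Lemma Im_inv_boundary_point y : `|y - x0| < r ->
  Im (boundary_point y)^-1 = - polar_density k c (th y).
Proof.
move=> hy; have tpi := angle_in hy; have wt := wpos tpi.
have sN : sin (th y) != 0 by rewrite gt_eqF // sin_gt0_pi.
have wN : w y != 0 by rewrite gt_eqF.
rewrite Im_invc /= /polar_density /cot.
have -> : (w y * (cos (th y) / sin (th y))) ^+ 2 + w y ^+ 2 =
   (w y / sin (th y)) ^+ 2 * (cos (th y) ^+ 2 + sin (th y) ^+ 2) by field.
by rewrite cos2Dsin2; field; rewrite sN wN.
Qed.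

Lemma analytic_polar_density (kappa : R) :
  analytic_at (fun y => kappa * polar_density k c (th y)) x0.
Proof.
have h0 : `|x0 - x0| < r by rewrite subrr normr0.
have tpi := angle_in h0; have wt := wpos tpi.
have cw : {for x0, continuous w}.
  apply: (@der_continuous _ _ _ (c * (dXfun k c (th x0))^-1)).
  by apply: der_ext (derD (der_cst k x0) (derMl c (der_angle h0))) _ _ => //; rewrite add0r.
have w2 : w x0 / 2 < w x0 by rewrite ltr_pdivrMr // ltr_pMr // ltr1n.
(* Continuity of the width supplies the lower bound [w x0 / 2] on [Im z] that the derivative
   estimates require. *)
have [e e0 he] := cvgr_gt _ cw _ w2.
pose r' := Num.min r e.
have r'0 : 0 < r' by rewrite lt_min r0.
have r'P y : `|y - x0| < r' -> `|y - x0| < r /\ w x0 / 2 <= w y.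
  rewrite lt_min => /andP[h1 h2]; split => //; apply/ltW/he.
  by rewrite /ball_ /= distrC.
apply: (@analytic_at_near _ (fun y => - kappa * Im (boundary_point y)^-1) _ _ r') => //.
  by move=> y /r'P[h _]; rewrite Im_inv_boundary_point // mulrNN.
apply: (@analytic_Im_inv R boundary_point c x0 r' (w x0 / 2)) => //.
- by rewrite divr_gt0.
- by move=> y /r'P[].
- by move=> y /r'P[h _]; exact: cder_boundary_point.
Qed.

End BoundaryAngle.

(** * The measures [nu_{1,rho}] *)

Section StableOne.
Variable R : realType.
Implicit Types (rho x t : R) (nu : probability (measurableTypeR R) R).
Local Notation c0 := (2 / pi : R).

Lemma c0_gt0 : 0 < c0.
Proof. by rewrite divr_gt0 ?pi_gt0. Qed.

(** Barycentric form of an affine function with end values [2 rho] at 0 and [2 (1 - rho)] at pi,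
    from which lower bounds are read. *)
Lemma width_convex rho t :
  2 * rho + slope rho * t = 2 * rho * (1 - t / pi) + 2 * (1 - rho) * (t / pi).
Proof. by rewrite /slope; move: (@pi_neq0 R); move: pi => p p0; field. Qed.

Lemma angle_ratio t : 0 < t < pi -> 0 < t / pi < 1.
Proof.
move=> /andP[t0 tp]; rewrite divr_gt0 ?pi_gt0 //=.
by rewrite ltr_pdivrMr ?pi_gt0 // mul1r.
Qed.

Lemma width_ge rho : 0 < rho < 1 ->
  exists2 m : R, 0 < m & forall t, 0 < t < pi -> m <= 2 * rho + slope rho * t.
Proof.
move=> /andP[r0 r1]; exists (2 * Num.min rho (1 - rho)).
  by rewrite mulr_gt0 // lt_min r0 subr_gt0.
move=> t /angle_ratio; rewrite width_convex; move: (t / pi) => s /andP[s0 s1].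
have h1 : Num.min rho (1 - rho) <= rho by rewrite ge_min lexx.
have h2 : Num.min rho (1 - rho) <= 1 - rho by rewrite ge_min lexx orbT.
move: (Num.min _ _) h1 h2 => m h1 h2.
have a1 : m * (1 - s) <= rho * (1 - s) by rewrite ler_wpM2r // subr_ge0 ltW.
have a2 : m * s <= (1 - rho) * s by rewrite ler_wpM2r // ltW.
by rewrite -!mulrA; lra.
Qed.

Lemma nu1_angles rho nu x : is_nu1 rho nu -> exists th : nat -> R,
  [/\ forall n, 0 < th n < pi,
      forall n, x = Xfun (2 * rho + harmonic n) (slope rho) (th n) &
      forall n, smoothed nu (harmonic n) x =
        polar_density (2 * rho + harmonic n) (slope rho) (th n)].
Proof.
move=> hnu.
have h n : exists t, [/\ 0 < t < pi, x = Xfun (2 * rho + harmonic n) (slope rho) t &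
    smoothed nu (harmonic n) x = polar_density (2 * rho + harmonic n) (slope rho) t].
  have [t [t1 _ t3 t4]] := nu1_polar x hnu (harmonic_gt0R R n).
  by exists t; split => //; rewrite ?/Xfun ?/polar_density addrAC.
have [th hth] := choice h.
by exists th; split => n; have [] := hth n.
Qed.

Lemma density_of_limit nu (q : R -> R) (C : R) :
  (forall x, smoothed nu (harmonic n) x @[n --> \oo] --> q x) ->
  (forall n x, smoothed nu (harmonic n) x <= C) ->
  has_density nu (fun x => q x / pi).
Proof.
move=> h1 h2; split.
- exact: measurable_limit_pi h1.
- exact: limit_pi_ge0 h1.
- exact: stieltjes_inversion h1 h2.
Qed.

Lemma Xfun_onto rho x : 0 < rho < 1 ->
  exists t, 0 < t < pi /\ x = Xfun (2 * rho) (slope rho) t.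
Proof.
move=> r01; have [m m0 hm] := width_ge r01.
have wpos t : 0 < t < pi -> 0 < 2 * rho + slope rho * t by move=> /hm; exact: lt_le_trans.
have /andP[r0 r1] := r01.
have k0 : 0 < 2 * rho by rewrite mulr_gt0.
have kpi : 0 < 2 * rho + slope rho * pi.
  rewrite width_convex divff ?pi_neq0 // subrr mulr0 add0r mulr1.
  by rewrite mulr_gt0 // subr_gt0.
have [s [s1 _ s2]] := Xfun_unbounded_above (slope rho) x k0.
have [t [t1 _ t2]] := Xfun_unbounded_below x kpi.
exact: (Xfun_IVT wpos s1 t1 t2 s2).
Qed.

Lemma nu1_interior rho nu : 0 < rho < 1 -> is_nu1 rho nu ->
  (forall x, exists! t, 0 < t < pi /\ x = Xfun (2 * rho) (slope rho) t) /\
  exists psi : R -> R,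
    [/\ has_density nu psi, forall x, 0 < psi x, analytic_on [set: R] psi &
        forall x t, 0 < t < pi -> x = Xfun (2 * rho) (slope rho) t ->
          psi x = 1 / pi * polar_density (2 * rho) (slope rho) t].
Proof.
move=> r01 hnu; have [m m0 hm] := width_ge r01.
set k := 2 * rho in hm *; set c := slope rho in hm *.
have wpos t : 0 < t < pi -> 0 < k + c * t by move=> /hm; exact: lt_le_trans.
have onto x := Xfun_onto x r01; rewrite -/k -/c in onto.
split.
  move=> x; have [t [tpi xt]] := onto x; exists t; split=> // s [spi xs].
  by apply: (Xfun_inj wpos) => //; rewrite -xt.
pose q x := polar_density k c (boundary_angle k c x).
exists (fun x => q x / pi); split.
- apply: (@density_of_limit nu q m^-1) => [x|n x].
    have [th [h1 h2 h3]] := nu1_angles x hnu.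
    have [tpi xt] := boundary_angleP (onto x).
    under eq_fun do rewrite h3.
    by apply: (polar_density_cvg wpos _ _ h1 h2) => //; [exact: harmonic_gt0R|exact: cvg_harmonic].
  have [th [h1 h2 h3]] := nu1_angles x hnu.
  rewrite h3 /polar_density -[m^-1]mul1r.
  have wm : m <= k + harmonic n + c * th n.
    by apply: le_trans (hm _ (h1 n)) _; rewrite addrAC lerDl ltW // harmonic_gt0R.
  apply: ler_pM; rewrite ?sqr_ge0 ?invr_ge0 ?(le_trans (ltW m0)) //.
  by rewrite lef_pV2 ?posrE // (lt_le_trans m0).
- move=> x; have [tpi _] := boundary_angleP (onto x).
  by rewrite divr_gt0 ?pi_gt0 // divr_gt0 ?wpos // exprn_gt0 // sin_gt0_pi.
- move=> x _.
  apply: (@analytic_at_near _ (fun y => pi^-1 * polar_density k c (boundary_angle k c y)) _ x 1 ltr01).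
    by move=> y _; rewrite mulrC.
  exact: (analytic_polar_density wpos ltr01).
- move=> x t tpi xt; rewrite /q mul1r mulrC; congr (_ * polar_density k c _).
  have [h1 h2] := boundary_angleP (onto x).
  by apply: (Xfun_inj wpos) => //; rewrite -h2.
Qed.

Definition edge : R := c0 * (1 + ln c0^-1).

(** At [edge] itself the value is 0, in agreement with the limit of [smoothed], because [X] does not
    attain its supremum. *)
Definition limit0 x : R :=
  if x < edge then polar_density 0 c0 (boundary_angle 0 c0 x) else 0.

Lemma slope0 : slope 0 = c0.
Proof. by rewrite /slope mulr0 subr0 mulr1. Qed.

Lemma Xfun0_onto x : x < edge -> exists t, 0 < t < pi /\ x = Xfun 0 c0 t.
Proof.
move=> xe; have wpos := wpos0 c0_gt0.
have kpi : 0 < 0 + c0 * pi by rewrite add0r mulr_gt0 ?c0_gt0 ?pi_gt0.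
have [t [t1 _ t2]] := Xfun_unbounded_below x kpi.
have [s [s1 s2]] := Xfun0_near c0_gt0 xe.
exact: (Xfun_IVT wpos s1 t1 t2 s2).
Qed.

Lemma limit0_cvg nu x : is_nu1 0 nu ->
  smoothed nu (harmonic n) x @[n --> \oo] --> limit0 x.
Proof.
move=> hnu; have [th [h1 h2 h3]] := nu1_angles x hnu.
rewrite mulr0 slope0 in h2 h3.
under eq_fun do rewrite h3.
rewrite /limit0; have [xe|xe] := ltP x edge.
  have [tpi xt] := boundary_angleP (Xfun0_onto xe).
  by apply: (polar_density_cvg (wpos0 c0_gt0) _ _ h1 h2) => //; [exact: harmonic_gt0R|exact: cvg_harmonic].
apply: (polar_density_cvg0 c0_gt0 _ _ h1 h2); [exact: harmonic_gt0R|exact: cvg_harmonic|].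
by move=> t tpi; apply: lt_le_trans xe; exact: Xfun0_lt c0_gt0 tpi.
Qed.

Lemma smoothed0_le nu n x : is_nu1 0 nu -> smoothed nu (harmonic n) x <= pi / c0.
Proof.
move=> hnu; have [th [h1 h2 h3]] := nu1_angles x hnu.
rewrite h3 mulr0 slope0 add0r.
have /andP[_ h] := polar_density0_le c0_gt0 (h1 n) (ltW (harmonic_gt0R R n)).
apply: le_trans h _; rewrite ler_wpM2r ?invr_ge0 ?(ltW c0_gt0) //.
by have /andP[_ /ltW] := h1 n.
Qed.

Lemma nu10_has_density nu : is_nu1 0 nu -> has_density nu (fun x => limit0 x / pi).
Proof.
move=> hnu; apply: (@density_of_limit nu limit0 (pi / c0)) => [x|n x].
  exact: limit0_cvg.
exact: smoothed0_le.
Qed.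

Lemma limit0_gt0 x : x < edge -> 0 < limit0 x.
Proof.
move=> xe; rewrite /limit0 xe; have [tpi _] := boundary_angleP (Xfun0_onto xe).
by rewrite divr_gt0 ?(wpos0 c0_gt0) // exprn_gt0 // sin_gt0_pi.
Qed.

(** Beyond the edge the density vanishes. For [x <= edge], a neighbourhood of [x] contains an
    interval strictly to the left of [x], on which the density is positive; choosing it on the left
    includes [x = edge]. *)
Lemma nu10_support nu : is_nu1 0 nu -> measure_support nu = `]-oo, edge]%classic.
Proof.
move=> hnu.
have [mpsi psi0 dens] := nu10_has_density hnu.
apply/seteqP; split => x /=.
  move=> hx; rewrite in_itv /= leNgt; apply/negP => xe.
  have := hx `]edge, +oo[%classic; rewrite /= in_itv /= xe.
  move=> /(_ (@rray_open _ _ edge) isT).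
  rewrite dens; last exact: measurable_itv.
  rewrite integral0_eq ?ltxx // => y; rewrite /= in_itv /= andbT => ye.
  by rewrite /limit0 ltNge (ltW ye) /= mul0r.
rewrite in_itv /= => xe U oU Ux.
have [d d0 hd] : exists2 d : R, 0 < d & ball x d `<=` U by move: (open_nbhs_nbhs (conj oU Ux)) => /nbhs_ballP.
pose D : set (measurableTypeR R) := `[(x - d / 2), (x - d / 4)]%classic.
have mD : measurable D by exact: measurable_itv.
have DU : D `<=` U.
  move=> y; rewrite /D /= in_itv /= => /andP[y1 y2]; apply: hd.
  by rewrite /ball /= ger0_norm; lra.
have mU : measurable (U : set (measurableTypeR R)) by exact: open_measurable.
apply: (@lt_le_trans _ _ (nu D)); last by apply: le_measure; rewrite ?inE.
rewrite lt_neqAle measure_ge0 andbT eq_sym; apply/eqP; rewrite dens // => h0.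
have mf : measurable_fun D (fun y => (limit0 y / pi)%:E).
  by apply: measurable_funTS; apply/measurable_EFinP.
have [|N [mN N0 sN]] := (ae_eq_integral_abs (@lebesgue_measure R) mD mf).1 _.
  by rewrite -[RHS]h0; apply: eq_integral => y _; rewrite gee0_abs // lee_fin.
have DN : D `<=` N.
  move=> y Dy; apply: sN => /(_ Dy) [] /eqP.
  move: Dy; rewrite /D /= in_itv /= => /andP[_ y2].
  by rewrite gt_eqF // divr_gt0 ?pi_gt0 // limit0_gt0 //; lra.
have : (@lebesgue_measure R D <= @lebesgue_measure R N)%E by apply: le_measure; rewrite ?inE.
rewrite N0 /D; have := @lebesgue_measure_itv R `[(x - d / 2), (x - d / 4)] => ->.
rewrite /= lte_fin (_ : x - d / 2 < x - d / 4); last by lra.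
by rewrite -EFinD lee_fin; lra.
Qed.

Lemma nu10_density nu : is_nu1 0 nu ->
  exists psi : R -> R,
    [/\ has_density nu psi, analytic_on `]-oo, edge[%classic psi &
        forall x t, x < edge -> 0 < t < pi -> x = Xfun 0 c0 t ->
          psi x = pi^-1 * polar_density 0 c0 t].
Proof.
move=> hnu; exists (fun x => limit0 x / pi); split.
- exact: nu10_has_density.
- move=> x; rewrite /= in_itv /= => xe.
  have r0 : 0 < edge - x by rewrite subr_gt0.
  have near_lt y : `|y - x| < edge - x -> y < edge.
    by rewrite ltr_norml => /andP[_]; rewrite ltrD2r.
  apply: (@analytic_at_near _ (fun y => pi^-1 * polar_density 0 c0 (boundary_angle 0 c0 y)) _ x _ r0).
    by move=> y /near_lt ye; rewrite /limit0 ye mulrC.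
  apply: (analytic_polar_density (wpos0 c0_gt0) r0) => y /near_lt; exact: Xfun0_onto.
- move=> x t xe tpi xt; rewrite /limit0 xe mulrC; congr (_ * polar_density 0 c0 _).
  have [h1 h2] := boundary_angleP (Xfun0_onto xe).
  by apply: (Xfun_inj (wpos0 c0_gt0)) => //; rewrite -h2.
Qed.

(** At the same height [e], the angle of [nu1] at [x] is pi minus the angle of [nu0] at [- x]; the
    widths agree because [(2 / pi) pi = 2]. *)
Lemma smoothed_reflect nu0 nu1 n x : is_nu1 0 nu0 -> is_nu1 1 nu1 ->
  smoothed nu1 (harmonic n) x = smoothed nu0 (harmonic n) (- x).
Proof.
move=> hnu0 hnu1.
have [th0 [a0 /(_ n) b0 ->]] := nu1_angles (- x) hnu0.
have [th1 [a1 /(_ n) b1 ->]] := nu1_angles x hnu1.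
have s1 : slope 1 = - c0 by rewrite /slope mulr1 (_ : 1 - 2 = -1) ?mulrN1 //; lra.
rewrite s1 in b1 *; rewrite mulr0 slope0 add0r in b0 *.
set e := harmonic n in b0 b1 *.
have e0 : 0 < e by exact: harmonic_gt0R.
have kE : 2 * 1 + e = e + c0 * pi.
  by rewrite mulr1 divfK ?pi_neq0 // addrC.
rewrite kE in b1 *.
have wpos t : 0 < t < pi -> 0 < e + c0 * pi + - c0 * t.
  move=> /andP[_ t1]; rewrite mulNr -addrA -mulrBr ltr_wpDl ?(ltW e0) //.
  by rewrite mulr_gt0 ?c0_gt0 // subr_gt0.
have rpi : 0 < pi - th0 n < pi.
  by have /andP[t0 t1] := a0 n; rewrite subr_gt0 t1 /= ltrBlDr ltrDl.
have tE : th1 n = pi - th0 n.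
  by apply: (Xfun_inj wpos) => //; rewrite Xfun_reflect -b0 opprK -b1.
rewrite /polar_density tE sinB sinpi cospi mul0r mulN1r sub0r opprK.
by congr (_ / _); ring.
Qed.

(** Both measures have densities, mirror images of each other by [smoothed_reflect], and Lebesgue
    measure is invariant under [x -> - x]. *)
Lemma nu11_reflect nu0 nu1 (A : set (measurableTypeR R)) :
  is_nu1 0 nu0 -> is_nu1 1 nu1 -> measurable A ->
  nu1 A = pushforward nu0 (-%R : measurableTypeR R -> measurableTypeR R) A.
Proof.
move=> h0 h1 mA.
have [mpsi psi0 dens0] := nu10_has_density h0.
have [||mpsi1 _ dens1] := @density_of_limit nu1 (fun x => limit0 (- x)) (pi / c0).
- move=> x; under eq_fun do rewrite (smoothed_reflect _ _ h0 h1).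
  exact: limit0_cvg.
- by move=> n x; rewrite (smoothed_reflect _ _ h0 h1); exact: smoothed0_le.
have mopp : measurable_fun [set: measurableTypeR R] (-%R : measurableTypeR R -> measurableTypeR R).
  exact: oppr_measurable.
have mA' : measurable ((-%R : measurableTypeR R -> measurableTypeR R) @^-1` A).
  by rewrite -[X in measurable X]setTI; exact: mopp.
rewrite dens1 // /pushforward dens0 //.
have mf : measurable_fun A (fun x => (limit0 (- x) / pi)%:E).
  by apply: measurable_funTS; apply/measurable_EFinP.
have -> : (\int[lebesgue_measure]_(x in (-%R : measurableTypeR R -> measurableTypeR R) @^-1` A)
    (limit0 x / pi)%:E)%E =
  (\int[lebesgue_measure]_(x in (-%R : measurableTypeR R -> measurableTypeR R) @^-1` A)
    ((fun x => (limit0 (- x) / pi)%:E) \o (-%R : measurableTypeR R -> measurableTypeR R)) x)%E.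
  by apply: eq_integral => x _ /=; rewrite opprK.
rewrite -ge0_integral_pushforward //; last first.
  by move=> x _; rewrite lee_fin.
by apply: eq_measure_integral => //= B mB _; exact/esym/lebesgue_measureN.
Qed.

End StableOne.

Theorem propositionA1p3 (R : realType) :
  (forall (rho : R) (nu : probability (measurableTypeR R) R),
      0 < rho < 1 -> is_nu1 rho nu ->
      let w (theta : R) : R := 2 * rho + 2 / pi * (1 - 2 * rho) * theta in
      let X (theta : R) : R :=
        w theta * cot theta
        + 2 / pi * (1 - 2 * rho) * ln (sin theta / w theta) in
      (forall x : R, exists! theta : R, 0 < theta < pi /\ x = X theta) /\
      exists psi : R -> R,
        [/\ has_density nu psi,
            forall x, 0 < psi x,
            analytic_on [set: R] psi &
            forall x theta : R, 0 < theta < pi -> x = X theta ->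
              psi x = 1 / pi * (sin theta ^+ 2 / w theta)]) /\
  (forall nu : probability (measurableTypeR R) R, is_nu1 0 nu ->
      let X (theta : R) : R :=
        2 / pi * theta * cot theta
        + 2 / pi * ln (pi * sin theta / (2 * theta)) in
      measure_support nu = [set` `]-oo, 2 / pi * (1 + ln (pi / 2))]] /\
      (forall x : R, interior (measure_support nu) x ->
        exists! theta : R, 0 < theta < pi /\ x = X theta) /\
      exists psi : R -> R,
        [/\ has_density nu psi,
            analytic_on (interior (measure_support nu)) psi &
            forall x theta : R, interior (measure_support nu) x ->
              0 < theta < pi -> x = X theta ->
              psi x = sin theta ^+ 2 / (2 * theta)]) /\
  (forall nu0 nu1 : probability (measurableTypeR R) R,
      is_nu1 0 nu0 -> is_nu1 1 nu1 ->
      forall A : set (measurableTypeR R), measurable A ->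
        nu1 A = pushforward nu0 (-%R : measurableTypeR R -> measurableTypeR R) A).

Proof.
split; [|split].
- move=> rho nu r01 hnu; exact: (nu1_interior r01 hnu).
- move=> nu hnu X.
  have edgeE : 2 / pi * (1 + ln (pi / 2)) = edge R by rewrite /edge invf_div.
  have XE t : X t = Xfun 0 (2 / pi) t.
    rewrite /X /Xfun add0r; congr (_ * _ + _ * ln _).
    by rewrite -[2 / pi * t]mulrAC invf_div mulrA [_ * pi]mulrC.
  have intE : interior (measure_support nu) = `]-oo, edge R[%classic.
    by rewrite nu10_support // interior_itv.
  have [psi [dens ana val]] := nu10_density hnu.
  split; [|split].
  + by rewrite nu10_support // edgeE.
  + move=> x; rewrite intE /= in_itv /= => /Xfun0_onto[t [tpi xt]].
    exists t; split; first by rewrite XE.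
    move=> s [spi]; rewrite XE => xs.
    by apply: (Xfun_inj (wpos0 (c0_gt0 R))) => //; rewrite -xs.
  + exists psi; split => //; first by rewrite intE.
    move=> x t; rewrite intE /= in_itv /= XE => xe tpi xt; rewrite (val x t) //.
    have /andP[t0 _] := tpi.
    rewrite /polar_density add0r; move: (@pi_neq0 R); move: pi => p p0.
    by field; rewrite p0 gt_eqF.
- by move=> nu0 nu1 h0 h1 A mA; exact: nu11_reflect.
Qed.
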